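(* Fix $t\in E$ and assume condition (A) at $t$ (see context). Let $(\alpha_{m_t})\subset(0,1)$ be a sequence such that, as $n\to\infty$, $\alpha_{m_t}\to 0$ and $m_t\alpha_{m_t}\to\infty$. If $$(m_t\alpha_{m_t})^2\,\omega_n\big(m_t^{-(1+\delta)}\big)\to 0\quad\text{for some }\delta>0,$$ then, as $n\to\infty$, $$(m_t\alpha_{m_t})^{1/2}\left(\frac{\hat q_1(\alpha_{m_t},t)}{q(\alpha_{m_t},t)}-1\right)\xrightarrow{d}\mathcal N(0,\gamma^2(t)),$$ where $\hat q_1(\alpha_{m_t},t)=Z_{m_t-\lfloor m_t\alpha_{m_t}\rfloor+1,m_t}(t)$ and $\xrightarrow{d}$ denotes convergence in distribution.
   Context: Setting. $(E,d)$ is a (finite or infinite dimensional) metric space. For $x\in E$, $F(\cdot,x)$ is the conditional cumulative distribution function of a real random variable $Y$ given $x$, and $q(\alpha,x)\in(0,\infty)$ is the conditional quantile of order $1-\alpha$, defined by $F(q(\alpha,x),x)=1-\alpha$ for all $\alpha\in(0,1)$. For every $x\in E$ the distribution is heavy-tailed: there is $\gamma(x)>0$ (the conditional tail index) such that $\lim_{\alpha\to0}q(\lambda\alpha,x)/q(\alpha,x)=\lambda^{-\gamma(x)}$ for all $\lambda>0$. Data. $(Y_1,x_1),\dots,(Y_n,x_n)$ are observations with non-random design points $x_i\in E$ and independent $Y_i$, $Y_i$ having distribution function $F(\cdot,x_i)$. For $t\in E$, $B(t,r)=\{x\in E: d(x,t)\le r\}$, and $h_t=h_{n,t}$ is a positive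 sequence tending to $0$ as $n\to\infty$. $m_t=m_{n,t}=\sum_{i=1}^n\mathbb 1\{x_i\in B(t,h_t)\}$ is the (non-random) number of design points in $B(t,h_t)$; $Z_1(t),\dots,Z_{m_t}(t)$ are the $Y_i$'s for which $x_i\in B(t,h_t)$, with order statistics $Z_{1,m_t}(t)\le\dots\le Z_{m_t,m_t}(t)$. $\lfloor\cdot\rfloor$ is the integer part. Condition (A) (at the fixed point $t$): the function $\alpha\in(0,1)\mapsto q(\alpha,t)\in(0,\infty)$ is differentiable, and the function $\alpha\in(0,1)\mapsto\Delta(\alpha,t)=\gamma(t)+\alpha\,\frac{\partial\log q}{\partial\alpha}(\alpha,t)\in\mathbb R$ is continuous with $\lim_{\alpha\to0}\Delta(\alpha,t)=0$. Oscillation: for $a\in(0,1/2)$, $\omega_n(a)=\sup\{|\log(q(\alpha,x)/q(\alpha,x'))| : \alpha\in(a,1-a),\ (x,x')\in B(t,h_t)^2\}$. *)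

(* Defs.v *)
From HB Require Import structures.
From mathcomp Require Import all_boot all_order all_algebra.
From mathcomp Require Import all_classical all_reals all_analysis.

Set Implicit Arguments.
Unset Strict Implicit.
Unset Printing Implicit Defensive.

Import Order.TTheory GRing.Theory Num.Theory.
Import numFieldNormedType.Exports.

Local Open Scope classical_set_scope.
Local Open Scope ring_scope.

Definition mutually_independent d (T : measurableType d) (R : realType)
    (P : probability T R) (Y : nat -> {RV P >-> R}) : Prop :=
  forall (J : seq nat) (B : nat -> set R),
    uniq J -> (forall i, measurable (B i)) ->
    P (\bigcap_(i in [set` J]) (Y i @^-1` B i))
      = (\prod_(i <- J) P (Y i @^-1` B i))%E.

(* Convergence of the distribution functions at every continuity point of the
   distribution function of the limit law mu. The measurability of the X n is
   part of the definition, as P is only meaningful on measurable sets. *)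
Definition cvg_in_distribution d (T : measurableType d) (R : realType)
    (P : probability T R) (X : nat -> T -> R)
    (mu : probability (measurableTypeR R) R) : Prop :=
  (forall n, measurable_fun [set: T] (X n)) /\
  forall y : R, {for y, continuous (fun r : R => mu `]-oo, r]%classic)} ->
    P [set w | X n w <= y] @[n --> \oo] --> mu `]-oo, y]%classic.

Definition cball (R : realType) (E : metricType R) (t : E) (r : R) : set E :=
  [set x | mdist x t <= r].

(* q a x is the quantile of order 1 - a of F x; only a in ]0, 1[ matters. *)
Definition is_quantile (R : realType) (E : Type)
    (F : E -> cumulativeBounded (0 : R) (1 : R)) (q : R -> E -> R) : Prop :=
  forall (x : E) (a : R), 0 < a < 1 -> 0 < q a x /\ F x (q a x) = 1 - a.

Definition heavy_tailed (R : realType) (E : Type) (q : R -> E -> R)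
    (gamma : E -> R) : Prop :=
  forall x : E, 0 < gamma x /\
    forall lam : R, 0 < lam ->
      q (lam * a) x / q a x @[a --> 0^'+] --> lam `^ (- gamma x).

Definition Delta (R : realType) (E : Type) (q : R -> E -> R) (gamma : E -> R)
    (t : E) (a : R) : R :=
  gamma t + a * derive1 (fun b => ln (q b t)) a.

Definition condition_A (R : realType) (E : Type) (q : R -> E -> R)
    (gamma : E -> R) (t : E) : Prop :=
  [/\ forall a : R, 0 < a < 1 -> derivable (fun b => q b t) a 1,
      {in `]0, 1[, continuous (Delta q gamma t)} &
      Delta q gamma t a @[a --> 0^'+] --> (0 : R)].

(* The supremum is taken in the extended reals: it may be infinite. *)
Definition oscillation (R : realType) (E : Type) (q : R -> E -> R)
    (B : set E) (a : R) : \bar R :=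
  ereal_sup [set z | exists (b : R) (x x' : E),
    [/\ a < b < 1 - a, B x, B x' & z = `|ln (q b x / q b x')|%:E]].

(* The n first observations are those of indices 0, ..., n - 1. *)
Definition local_count (R : realType) (E : metricType R) (x : nat -> E)
    (t : E) (h : nat -> R) (n : nat) : nat :=
  (\sum_(i < n) (x i \in cball t (h n)))%N.

Definition local_sample (R : realType) (E : metricType R) (T : Type)
    (x : nat -> E) (Y : nat -> T -> R) (t : E) (h : nat -> R) (n : nat) (w : T)
    : seq R :=
  [seq Y i w | i <- iota 0 n & x i \in cball t (h n)].

(* k-th smallest item of s, for 1 <= k <= size s (and 0 beyond size s) *)
Definition order_stat (R : realType) (s : seq R) (k : nat) : R :=
  nth 0 (sort <=%R s) k.-1.

(* a stands for the order alpha; for a in ]0, 1[, the truncated subtraction is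
   a true one, and the rank exceeds m only if m * a < 1. *)
Definition qhat1 (R : realType) (E : metricType R) (T : Type)
    (x : nat -> E) (Y : nat -> T -> R) (t : E) (h : nat -> R) (n : nat) (a : R)
    (w : T) : R :=
  let m := local_count x t h n in
  order_stat (local_sample x Y t h n w) (m - Num.truncn (m%:R * a) + 1)%N.

(* Main.v *)
(** The estimator is at most q(α)(1 + y/√(mα)) =: u exactly when fewer than
    k = ⌊mα⌋ of the m local observations exceed u. These exceedances are
    independent Bernoulli trials, and the distribution function of their sum
    decreases in each success probability. The regularity of q(·, t) (through
    the mean value theorem applied to log q + γ log) and the oscillation bound
    enclose all success probabilities between two values
    (k - 1)/(m - 1) · (1 - (y ± ε)/(γ√(k - 1))), so that the distribution
    function of the sum is enclosed between two binomial ones. The binomial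
    distribution function is an incomplete beta integral; on the scale of y its
    integrand tends to the Gaussian density and is dominated by a two-sided
    exponential, so that dominated convergence gives the normal limit. *)

Require Import Defs.
From HB Require Import structures.
From mathcomp Require Import all_boot all_order all_algebra.
From mathcomp Require Import all_classical all_reals all_analysis.
From mathcomp Require Import measurable_realfun ring lra zify.

Set Implicit Arguments.
Unset Strict Implicit.
Unset Printing Implicit Defensive.

Import Order.TTheory GRing.Theory Num.Theory.
Import numFieldNormedType.Exports.

Local Open Scope classical_set_scope.
Local Open Scope ring_scope.

(** * Numbers of successes in independent trials *)

Section bernoulli_sums.
Context {R : realType}.

(* The probability of strictly fewer than k successes in independent trials
   with success probabilities ps *)
Fixpoint bernoulli_cdf (ps : seq R) (k : nat) : R :=
  if ps is p :: ps' then
    if k is k'.+1 then p * bernoulli_cdf ps' k' + (1 - p) * bernoulli_cdf ps' k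
    else 0
  else (0 < k)%:R.

Lemma bernoulli_cdf_ge0 ps k : {in ps, forall p, 0 <= p <= 1} ->
  0 <= bernoulli_cdf ps k.
Proof.
elim: ps k => [|p ps IH] [|k] H //=.
have /andP[p0 p1] := H p (mem_head _ _).
have H' : {in ps, forall p, 0 <= p <= 1}.
  by move=> r rs; apply: H; rewrite inE rs orbT.
by rewrite addr_ge0// mulr_ge0 ?subr_ge0 ?IH.
Qed.

Lemma bernoulli_cdf_leS ps k : {in ps, forall p, 0 <= p <= 1} ->
  bernoulli_cdf ps k <= bernoulli_cdf ps k.+1.
Proof.
elim: ps k => [|p ps IH] k H; first by case: k.
have /andP[p0 p1] := H p (mem_head _ _).
have H' : {in ps, forall p, 0 <= p <= 1}.
  by move=> r rs; apply: H; rewrite inE rs orbT.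
case: k => [|k]; first exact: bernoulli_cdf_ge0.
by rewrite lerD// ler_wpM2l ?IH ?subr_ge0.
Qed.

(** Raising the probability of one trial from [f i] to [g i] lowers the value by [g i - f i] times
    an increment of the distribution function of the remaining trials, which is nonnegative. The
    trials are changed one at a time. *)
Lemma le_bernoulli_cdf (I : eqType) (s : seq I) (f g : I -> R) k :
  {in s, forall i, [/\ 0 <= f i, f i <= g i & g i <= 1]} ->
  bernoulli_cdf (map g s) k <= bernoulli_cdf (map f s) k.
Proof.
elim: s k => [|i s IH] [|k] H //=.
have [f0 fg g1] := H i (mem_head _ _).
have H' : {in s, forall i, [/\ 0 <= f i, f i <= g i & g i <= 1]}.
  by move=> r rs; apply: H; rewrite inE rs orbT.
have Hg : {in map g s, forall p, 0 <= p <= 1}.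
  move=> _ /mapP[j /H'[fj0 fgj gj1] ->].
  by rewrite gj1 andbT (le_trans fj0).
(* In the middle term only the first trial has gone back to [f i]. *)
apply: (@le_trans _ _ (f i * bernoulli_cdf (map g s) k +
                       (1 - f i) * bernoulli_cdf (map g s) k.+1)).
  rewrite -subr_ge0.
  have -> : f i * bernoulli_cdf (map g s) k +
     (1 - f i) * bernoulli_cdf (map g s) k.+1 -
     (g i * bernoulli_cdf (map g s) k +
      (1 - g i) * bernoulli_cdf (map g s) k.+1) =
     (g i - f i) * (bernoulli_cdf (map g s) k.+1 - bernoulli_cdf (map g s) k).
    by ring.
  by rewrite mulr_ge0 ?subr_ge0 ?bernoulli_cdf_leS.
by rewrite lerD// ler_wpM2l ?IH ?subr_ge0// (le_trans fg).
Qed.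

End bernoulli_sums.

(** * Order statistics and the law of the number of exceedances *)

Section exceedances.
Context d (T : measurableType d) (R : realType) (P : probability T R).
Variable Y : nat -> {RV P >-> R}.

Lemma measurable_exceed (u : R) i : measurable [set w | u < Y i w].
Proof.
have : measurable (Y i @^-1` `]u, +oo[%classic).
  by apply: measurable_funPTI => //; exact: measurable_itv.
by congr measurable; apply/seteqP; split=> w /=; rewrite in_itv/= andbT.
Qed.

Lemma measurable_exceed_count (u : R) s k :
  measurable [set w | (count (fun i => (u < Y i w)%R) s < k)%N].
Proof.
elim: s k => [|i s IH] [|k] /=.
- by rewrite (_ : [set _ | _] = set0)//; apply/seteqP; split.
- by rewrite (_ : [set _ | _] = setT)//; apply/seteqP; split.
- by rewrite (_ : [set _ | _] = set0)//; apply/seteqP; split.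
rewrite (_ : [set _ | _] =
  ([set w | u < Y i w] `&`
     [set w | (count (fun i => (u < Y i w)%R) s < k)%N]) `|`
  (~` [set w | u < Y i w] `&`
     [set w | (count (fun i => (u < Y i w)%R) s < k.+1)%N])).
  apply: measurableU; apply: measurableI => //.
  - exact: measurable_exceed.
  - by apply: measurableC; exact: measurable_exceed.
apply/seteqP; split => w /=.
  by case: (u < Y i w) => /=; rewrite ?add1n ?add0n ?ltnS => H; [left|right].
by case=> -[]; [move=> -> | move=> /negP/negPf ->]; rewrite ?add1n ?add0n ?ltnS.
Qed.

(** In the sorted list, the [r]-th item is at most [u] exactly when the first [r] items are, which
    leaves at most [size s - r] items above [u]. *)
Lemma order_stat_le (s : seq R) (r : nat) (u : R) : (0 < r <= size s)%N ->
  (order_stat s r <= u) = (count (fun v => (u < v)%R) s < size s - r + 1)%N.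
Proof.
move=> /andP[r0 rs]; rewrite /order_stat.
set s' := sort _ s.
have ss : sorted <=%O s' by exact: sort_le_sorted.
have <- : size s' = size s by rewrite size_sort.
have <- : count (fun v => (u < v)%R) s' = count (fun v => (u < v)%R) s.
  by rewrite count_sort.
have rs' : (r <= size s')%N by rewrite size_sort.
have cE : (count (fun v => (u < v)%R) s' +
    count (predC (fun v => (u < v)%R)) s' = size s')%N.
  exact: count_predC.
have cE' : count (predC (fun v => (u < v)%R)) s' = count (<= u)%R s'.
  by apply: eq_count => v /=; rewrite leNgt.
have -> : (count (fun v => (u < v)%R) s' < size s' - r + 1)%N =
  (r.-1 < count (<= u)%R s')%N.
  by rewrite -cE'; lia.
apply/idP/idP; last exact: nth_count_le.
move=> H; rewrite -(cat_take_drop r s') count_cat.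
suff -> : count (<= u)%R (take r s') = r by lia.
transitivity (size (take r s')); last by rewrite size_takel.
apply/eqP; rewrite -all_count; apply/(all_nthP 0) => j.
rewrite size_takel// => jr; rewrite nth_take//=.
apply: le_trans H.
have jr' : (j <= r.-1 < size s')%N.
  by move: jr rs' r0; case: (r) => //=; lia.
by case/andP: jr' => *; apply: le_sorted_leq_nth; rewrite ?inE //=; lia.
Qed.

(** Independence is a product formula over finite lists of indices, so the induction carries side
    events [B i] on a list [r] disjoint from [s]. Splitting on whether the head of [s] exceeds [u]
    moves this index from [s] to [r]. *)
Lemma exceed_count_prob (u : R) (p : nat -> R) (s r : seq nat)
    (B : nat -> set R) k :
  mutually_independent Y ->
  (forall i, P (Y i @^-1` `]u, +oo[%classic) = (p i)%:E) ->
  (forall i, measurable (B i)) ->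
  uniq (s ++ r) ->
  P ((\bigcap_(i in [set` r]) (Y i @^-1` B i)) `&`
     [set w | (count (fun i => (u < Y i w)%R) s < k)%N]) =
  ((\prod_(i <- r) P (Y i @^-1` B i)) * (bernoulli_cdf (map p s) k)%:E)%E.
Proof.
move=> indep pE.
have mbig (r' : seq nat) (B' : nat -> set R) :
    (forall i, measurable (B' i)) ->
    measurable (\bigcap_(i in [set` r']) (Y i @^-1` B' i)).
  move=> mB'; apply: fin_bigcap_measurable => // i _.
  by apply: measurable_funPTI => //; exact: mB'.
have pE' i : P (Y i @^-1` `]-oo, u]%classic) = (1 - p i)%:E.
  rewrite -setCitvr preimage_setC probability_setC.
    by rewrite pE.
  apply: (measurable_funPTI (Y i) (Y := `]u, +oo[%classic)).
  exact: measurable_itv.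
elim: s r B k => [|i s IH] r B k mB.
  rewrite /= => ur; case: k => [|k] /=.
    rewrite (_ : _ `&` _ = set0) ?measure0 ?mule0//.
    by apply/seteqP; split => // w [].
  rewrite (_ : _ `&` _ = \bigcap_(i in [set` r]) (Y i @^-1` B i)).
    by rewrite indep// mule1.
  by apply/seteqP; split => // w [].
move=> usr; case: k => [|k].
  rewrite (_ : _ `&` _ = set0).
    by rewrite measure0 mule0.
  by apply/seteqP; split => // w [].
have [ir us] : i \notin r /\ uniq (s ++ i :: r).
  move: usr; rewrite /= mem_cat negb_or => /andP[/andP[is_ ir] u1]; split=> //.
  by rewrite -cat1s uniq_catCA cat1s /= mem_cat negb_or is_ ir u1.
(* [Bw C] imposes [C] on the moved index [i] and agrees with [B] on [r], because [i] is not in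
   [r]. *)
pose Bw C j := if j == i then C else B j.
have mBw C : measurable C -> forall j, measurable (Bw C j).
  by move=> mC j; rewrite /Bw; case: ifP.
have bigE C : \bigcap_(j in [set` i :: r]) (Y j @^-1` Bw C j) =
   (Y i @^-1` C) `&` \bigcap_(j in [set` r]) (Y j @^-1` B j).
  have Bwr j : j \in r -> Bw C j = B j.
    by move=> jr; rewrite /Bw ifN//; apply: contraNneq ir => <-.
  apply/seteqP; split => w /=.
    move=> H; split; first by have := H i (mem_head _ _); rewrite /= /Bw eqxx.
    by move=> j /= jr; rewrite /= -Bwr//; apply: H; rewrite /= inE jr orbT.
  move=> [H1 H2] j /=; rewrite inE; case: (eqVneq j i) => [->|ji]/= jr.
    by rewrite /Bw eqxx.
  by rewrite Bwr//; exact: H2.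
have prodE C : (\prod_(j <- i :: r) P (Y j @^-1` Bw C j) =
   P (Y i @^-1` C) * \prod_(j <- r) P (Y j @^-1` B j))%E.
  rewrite big_cons {1}/Bw eqxx; congr (_ * _)%E.
  rewrite big_seq [RHS]big_seq; apply: eq_bigr => j jr; rewrite /Bw ifN//.
  by apply: contraNneq ir => <-.
pose E C n := \bigcap_(j in [set` i :: r]) (Y j @^-1` Bw C j) `&`
  [set w | (count (fun i => (u < Y i w)%R) s < n)%N].
have mE C n : measurable C -> measurable (E C n).
  move=> mC; apply: measurableI; last exact: measurable_exceed_count.
  by apply: mbig; exact: mBw.
rewrite (_ : _ `&` _ =
    E `]u, +oo[%classic k `|` E `]-oo, u]%classic k.+1); last first.
  rewrite /E !bigE; apply/seteqP; split => w /=; rewrite !in_itv/= andbT.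
    move=> [H]; case: ltP => //= h.
      by rewrite add1n ltnS => H'; left.
    by rewrite add0n => H'; right.
  by case=> -[[H1 H2] H3]; split=> //; [rewrite H1|rewrite ltNge H1].
have -> : P (E `]u, +oo[%classic k `|` E `]-oo, u]%classic k.+1) =
    (P (E `]u, +oo[%classic k) + P (E `]-oo, u]%classic k.+1))%E.
  apply: measureU; [exact: mE|exact: mE|].
  rewrite /E !bigE; apply/seteqP; split => // w /=.
  rewrite !in_itv/= andbT => -[[[H1 _] _] [[H2 _] _]].
  by move: H1; rewrite ltNge H2.
rewrite /E (IH (i :: r) (Bw `]u, +oo[%classic) k)//; last exact: mBw.
rewrite (IH (i :: r) (Bw `]-oo, u]%classic) k.+1)//; last exact: mBw.
rewrite !prodE pE pE' -!muleA.
(* Finiteness of the product brings the final identity down to the real numbers. *)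
have fprod : (\prod_(j <- r) P (Y j @^-1` B j))%E \is a fin_num.
  rewrite -indep//; last by move: us; rewrite cat_uniq /= => /and4P[].
  by rewrite fin_num_measure//; exact: mbig.
rewrite -(fineK fprod) -!EFinM -EFinD /=; congr EFin.
by ring.
Qed.

End exceedances.

(** * The binomial distribution function as an incomplete beta integral *)

Section binomial_cdf.
Context {R : realType}.
Implicit Types p : R.

(* As for bernoulli_cdf, the number of successes is strictly less than k. *)
Definition binomial_cdf (m k : nat) p : R :=
  \sum_(j < k) 'C(m, j)%:R * (p ^+ j * (1 - p) ^+ (m - j)).

Lemma bernoulli_cdf_nseq m k p :
  bernoulli_cdf (nseq m p) k = binomial_cdf m k p.
Proof.
elim: m k => [|m IH] [|k].
- by rewrite /binomial_cdf big_ord0.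
- rewrite /binomial_cdf big_ord_recl big1 /= ?addr0 ?bin0 ?mulr1//.
  by move=> i _; rewrite mul0r.
- by rewrite /binomial_cdf big_ord0.
rewrite /= !IH /binomial_cdf !big_ord_recl /= !bin0 !subn0 !expr0 !mul1r.
rewrite mulrDr addrCA exprS; congr (_ + _).
rewrite 2!mulr_sumr -big_split /=; apply: eq_bigr => i _.
rewrite /bump /= add1n binS natrD subSS.
(* For [i < m] the exponent [m - i] is the successor of [m - i.+1]; otherwise ['C(m, i.+1)] vanishes
   and the truncated exponent is harmless. *)
have [im|im] := ltnP i m.
  by rewrite -(subnSK im) !exprS; ring.
rewrite (@bin_small m i.+1)//. by rewrite exprS; ring.
Qed.

Lemma is_derive_onemX m p :
  is_derive p 1 (fun u : R => (1 - u) ^+ m) (- (m%:R * (1 - p) ^+ m.-1)).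
Proof.
have dB : is_derive p 1 (fun u : R => 1 - u) (-1).
  have H : is_derive p 1 ((cst 1 : R -> R) - id) (0 - 1) by apply: is_deriveB.
  by rewrite sub0r in H.
rewrite (_ : (fun u => _) = (fun u : R => 1 - u) ^+ m); last first.
  by apply/funext => u; rewrite exprfctE.
by apply: is_derive_eq; rewrite /GRing.scale /= mulrN1.
Qed.

(** The derivatives of consecutive summands telescope, and the one term left is a multiple of a beta
    density. *)
Lemma is_derive_binomial_cdf m k p : is_derive p 1 (binomial_cdf m k.+1)
  (- ((k.+1 * 'C(m, k.+1))%:R * (p ^+ k * (1 - p) ^+ (m - k.+1)))).
Proof.
elim: k => [|k IH].
  have -> : binomial_cdf m 1 = fun u => (1 - u) ^+ m.
    by apply/funext => u; rewrite /binomial_cdf big_ord1 bin0 expr0 !mul1r subn0.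
  apply: is_derive_eq; first exact: is_derive_onemX.
  by rewrite bin1 mul1n expr0 mul1r subn1.
have -> : binomial_cdf m k.+2 = binomial_cdf m k.+1 +
    ('C(m, k.+1)%:R \*: ((fun u : R => u ^+ k.+1) *
                        (fun u : R => (1 - u) ^+ (m - k.+1)))).
  by apply/funext => u; rewrite /binomial_cdf big_ord_recr.
have dX : is_derive p 1 (fun u : R => u ^+ k.+1) (k.+1%:R * p ^+ k).
  rewrite (_ : (fun u => _) = (id : R -> R) ^+ k.+1); last first.
    by apply/funext => u; rewrite exprfctE.
  by apply: is_derive_eq; rewrite /GRing.scale /= mulr1.
have dY := is_derive_onemX (m - k.+1) p.
apply: is_derive_eq.
rewrite /GRing.scale /= !natrM.
have [km|km] := ltnP k.+1 m; last first.
  have [->|km'] := eqVneq m k.+1.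
    by rewrite subnn binn bin_small//=; ring.
  rewrite !bin_small//; first by ring.
  by rewrite ltn_neqAle km'.
(* One half of the product rule cancels the induction hypothesis; this identity puts the other half
   in the required form. *)
have E : k.+2%:R * 'C(m, k.+2)%:R = (m - k.+1)%:R * 'C(m, k.+1)%:R :> R.
  by rewrite -!natrM mul_bin_left.
have -> : (m - k.+2 = (m - k.+1).-1)%N by lia.
rewrite E; ring.
Qed.

Lemma binomial_cdf_at0 m k : binomial_cdf m k.+1 0 = 1.
Proof.
rewrite /binomial_cdf big_ord_recl big1 => [|i _].
  by rewrite bin0 subr0 expr1n expr0 !mulr1 addr0.
by rewrite /= expr0n /= mul0r mulr0.
Qed.

Lemma binomial_cdf_at1 m k : (k <= m)%N -> binomial_cdf m k 1 = 0.
Proof.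
move=> km; rewrite /binomial_cdf big1// => i _.
rewrite subrr expr0n subn_eq0 leqNgt (leq_trans (ltn_ord i) km) /=.
by rewrite !mulr0.
Qed.

End binomial_cdf.

(** * Normal approximation of the binomial distribution *)

Section beta_kernel.
Context {R : realType}.
Implicit Types w z s : R.

(* With p = K / (K + M) * (1 + w), this is p ^ K * (1 - p) ^ M divided by its
   maximum, attained at w = 0. *)
Definition beta_kernel (K M : nat) w : R :=
  (1 + w) ^+ K * (1 - K%:R / M%:R * w) ^+ M.

Lemma beta_kernel_ge0 K M w : -1 <= w -> K%:R / M%:R * w <= 1 ->
  0 <= beta_kernel K M w.
Proof.
by move=> w1 w2; rewrite mulr_ge0// exprn_ge0// ?subr_ge0// -lerBlDl sub0r.
Qed.

(* Applying ln t <= t - 1 at t = Num.sqrt (1 + w), rather than at 1 + w, yields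
   a quadratic gain. *)
Lemma ge1Dx_expRN_le w : -1 <= w ->
  (1 + w) * expR (- w) <= expR (- (Num.sqrt (1 + w) - 1) ^+ 2).
Proof.
move=> w1; set s := Num.sqrt _.
have w0 : 0 <= 1 + w by rewrite -lerBlDl sub0r.
have s0 : 0 <= s by exact: sqrtr_ge0.
have s2 : s ^+ 2 = 1 + w by rewrite sqr_sqrtr.
have -> : - (s - 1) ^+ 2 = (s - 1) *+ 2 + - w by rewrite -mulr_natr; nra.
rewrite expRD ler_wpM2r ?expR_ge0// -s2 -mulr_natl expRM_natl.
by rewrite lerXn2r ?nnegrE ?expR_ge0//; have := expR_ge1Dx (s - 1); lra.
Qed.

(** Since [1 - v <= expR (- v)], the kernel is at most the [K]-th power of [(1 + w) * expR (- w)],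
    hence at most the exponential of [- K (sqrt (1 + w) - 1)^2], and this quadratic is compared with
    a linear function. On the scale [w = - z / (sigma * sqrt K)] the resulting bound depends neither
    on [K] nor on [M]. *)
Lemma beta_kernel_le K M w : (0 < K)%N -> (0 < M)%N -> -1 <= w ->
  K%:R / M%:R * w <= 1 ->
  beta_kernel K M w <= expR (1 - Num.sqrt K%:R * `|w| / 2).
Proof.
move=> K0 M0 w1 w2.
have w0 : 0 <= 1 + w by rewrite -lerBlDl sub0r.
have KR : 1 <= K%:R :> R by rewrite ler1n.
have MR : 0 < M%:R :> R by rewrite ltr0n.
apply: (@le_trans _ _ (((1 + w) * expR (- w)) ^+ K)).
  rewrite exprMn -expRM_natl ler_wpM2l ?exprn_ge0//.
  rewrite (_ : K%:R * - w = M%:R * (- (K%:R / M%:R * w))); last first.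
    by field; rewrite gt_eqF.
  rewrite expRM_natl lerXn2r ?nnegrE ?expR_ge0 ?subr_ge0//.
  exact: expR_ge1Dx.
apply: (@le_trans _ _ (expR (- (Num.sqrt (1 + w) - 1) ^+ 2) ^+ K)).
  by rewrite lerXn2r ?nnegrE ?mulr_ge0 ?expR_ge0 ?ge1Dx_expRN_le.
rewrite -expRM_natl ler_expR.
set s := Num.sqrt (1 + w).
have s0 : 0 <= s by exact: sqrtr_ge0.
have s2 : s ^+ 2 = 1 + w by rewrite sqr_sqrtr.
set r := Num.sqrt K%:R.
have r2 : r ^+ 2 = K%:R by rewrite sqr_sqrtr.
have r1 : 1 <= r by rewrite -sqrtr1 ler_wsqrtr.
rewrite -r2.
have aw : `|w| = `|s - 1| * (s + 1).
  rewrite -[s + 1]ger0_norm -?normrM; last lra.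
  by congr `|_|; nra.
have a2 : (s - 1) ^+ 2 = `|s - 1| ^+ 2 by rewrite real_normK ?num_real.
have sle : s <= 1 + `|s - 1| by rewrite -lerBlDl ler_norm.
rewrite aw a2; move: sle (normr_ge0 (s - 1)); set a := `|_| => sle a0.
(* As [s + 1 <= 2 + a] and [1 <= r], the factor [s + 1] is at most [2 + r * a]; what then remains to
   show is [0 <= (r * a - 1) ^+ 2 + 1]. *)
have : r * (a * (s + 1)) <= 2 * (r * a) + (r * a) * (r * a).
  have -> : 2 * (r * a) + r * a * (r * a) = r * (a * (2 + r * a)) by ring.
  by rewrite ler_wpM2l ?ler_wpM2l//; nra.
have : 0 <= (r * a - 1) ^+ 2 + 1 by rewrite addr_ge0 ?sqr_ge0.
nra.
Qed.
Lemma is_derive_ln1D w : -1 < w ->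
  is_derive w 1 (fun u : R => ln (1 + u)) (1 + w)^-1.
Proof.
move=> w1.
have dD : is_derive w 1 (fun u : R => 1 + u) 1.
  have H : is_derive w 1 ((cst 1 : R -> R) + id) (0 + 1) by apply: is_deriveD.
  by rewrite add0r in H.
have dl : is_derive (1 + w) 1 (@ln R) (1 + w)^-1.
  by apply: is_derive1_ln; rewrite -ltrBlDl sub0r.
have := is_derive1_comp dl dD; rewrite mulr1; exact.
Qed.

(** The function under the absolute value has derivative [u ^+ 2 / (1 + u)], which is at most
    [2 * w ^+ 2] between 0 and [w]; the mean value theorem concludes. *)
Lemma ln1D_taylor2 w : `|w| <= 2^-1 ->
  `|ln (1 + w) - w + w ^+ 2 / 2| <= 2 * `|w| ^+ 3.
Proof.
move=> w2.
pose f (u : R) := ln (1 + u) - u + u ^+ 2 / 2.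
pose df (u : R) := u ^+ 2 / (1 + u).
have dfE (u : R) : -1 < u -> is_derive u 1 f (df u).
  move=> u1.
  have dl := is_derive_ln1D u1.
  have H : is_derive u 1
     ((fun u : R => ln (1 + u)) - id + 2^-1 \*: ((id : R -> R) ^+ 2))
     ((1 + u)^-1 - 1 + 2^-1 *: ((2%:R * u ^+ 1) *: 1)).
    apply: is_deriveD.
  have -> : f = (fun u : R => ln (1 + u)) - id + 2^-1 \*: ((id : R -> R) ^+ 2).
    by apply/funext => v; rewrite /f /= mulrC.
  apply: is_derive_eq.
  rewrite /df /GRing.scale /=; field; lra.
have fc (a b : R) : -1 < a -> {within `[a, b], continuous f}.
  move=> a1; apply: derivable_within_continuous => u.
  rewrite in_itv/= => /andP[au _].
  by have [] := dfE u (lt_le_trans a1 au).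
have f0 : f 0 = 0 by rewrite /f addr0 ln1; ring.
rewrite -/(f w).
have [w0|w0] := leP 0 w.
- rewrite (ger0_norm w0) in w2 *.
  have [||c] := @MVT_segment R f df 0 w w0.
  + by move=> u; rewrite in_itv/= => /andP[u0 _]; apply: dfE; lra.
  + by apply: fc; lra.
  rewrite in_itv/= f0 !subr0 => /andP[c0 cw] ->.
  have d0 : 0 <= df c <= w ^+ 2.
    rewrite /df divr_ge0 ?sqr_ge0 ?addr_ge0//= ler_pdivrMr; nra.
  rewrite ger0_norm; nra.
- rewrite (ltr0_norm w0) in w2 *.
  have [||c] := @MVT_segment R f df w 0 (ltW w0).
  + by move=> u; rewrite in_itv/= => /andP[u0 _]; apply: dfE; lra.
  + by apply: fc; lra.
  rewrite in_itv/= f0 !sub0r => /andP[c0 cw] /eqP.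
  rewrite -normrN => /eqP ->.
  have d0 : 0 <= df c <= 2 * w ^+ 2.
    rewrite /df divr_ge0 ?sqr_ge0//=; last lra.
    rewrite ler_pdivrMr; nra.
  rewrite ger0_norm; nra.
Qed.

Lemma ln1D_taylor1 w : `|w| <= 2^-1 -> `|ln (1 + w) - w| <= 2 * w ^+ 2.
Proof.
move=> w2; have := ln1D_taylor2 w2.
have -> : w ^+ 2 = `|w| ^+ 2 by rewrite real_normK ?num_real.
rewrite !ler_norml => /andP[]; have := normr_ge0 w; nra.
Qed.

Lemma sqrtr_cvgy (T : Type) (D : set_system T) (FD : Filter D) (f : T -> R) :
  f x @[x --> D] --> +oo -> Num.sqrt (f x) @[x --> D] --> +oo.
Proof.
move=> /cvgryPge fy; apply/cvgryPge => A.
near=> x.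
rewrite (le_trans (ler_norm A))// -sqrtr_sqr ler_wsqrtr//.
by near: x; exact: fy.
Unshelve. all: by end_near. Qed.

(** In the logarithm [K ln (1 + w) + M ln (1 - v)], with [v = K / M * w], the linear terms cancel
    and the quadratic term of the first logarithm is [- x ^+ 2 / 2]. The remainders are of order
    [1 / sqrt K] and [K / M]. *)
Lemma beta_kernel_cvg (K M : nat -> nat) (x : R) :
  (forall n, 0 < K n)%N -> (forall n, 0 < M n)%N ->
  (K n)%:R @[n --> \oo] --> (+oo : set_system R) ->
  (K n)%:R / (M n)%:R @[n --> \oo] --> (0 : R) ->
  beta_kernel (K n) (M n) (x / Num.sqrt (K n)%:R) @[n --> \oo] -->
    (expR (- (x ^+ 2) / 2) : R).
Proof.
move=> K0 M0 Ky KM0.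
pose r n := Num.sqrt (K n)%:R : R.
pose w n := x / r n.
pose v n := (K n)%:R / (M n)%:R * w n.
pose e n := (K n)%:R * ln (1 + w n) + (M n)%:R * ln (1 + - v n).
have r0 n : 0 < r n by rewrite sqrtr_gt0 ltr0n.
have r2 n : (K n)%:R = r n ^+ 2 by rewrite sqr_sqrtr.
have ry : r n @[n --> \oo] --> +oo by exact: sqrtr_cvgy.
have rV0 : (r n)^-1 @[n --> \oo] --> (0 : R).
  by apply/gtr0_cvgV0 => //; near=> n; exact: r0.
have w0 : w n @[n --> \oo] --> (0 : R).
  by rewrite -[0](mulr0 x); apply: cvgM => //; exact: cvg_cst.
have v0 : v n @[n --> \oo] --> (0 : R).
  by rewrite -[0](mulr0 0); exact: cvgM.
have half0 : 0 < 2^-1 :> R by rewrite invr_gt0.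
have w2 : \forall n \near \oo, `|w n| <= 2^-1 by move/cvgr0Pnorm_le: w0; exact.
have v2 : \forall n \near \oo, `|v n| <= 2^-1 by move/cvgr0Pnorm_le: v0; exact.
pose b n := 2 * `|x| ^+ 3 * (r n)^-1 + 2 * x ^+ 2 * ((K n)%:R / (M n)%:R).
have b0 : b n @[n --> \oo] --> (0 : R).
  have -> : (0 : R) = 2 * `|x| ^+ 3 * 0 + 2 * x ^+ 2 * 0 by ring.
  by apply: cvgD; apply: cvgM => //; exact: cvg_cst.
have eb : \forall n \near \oo, `|e n - - (x ^+ 2) / 2| <= b n.
  near=> n.
  have w2n : `|w n| <= 2^-1 by near: n.
  have v2n : `|- v n| <= 2^-1 by rewrite normrN; near: n.
  have MR : (M n)%:R != 0 :> R by rewrite pnatr_eq0 -lt0n.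
  have -> : e n - - x ^+ 2 / 2 =
    (K n)%:R * (ln (1 + w n) - w n + w n ^+ 2 / 2) +
    (M n)%:R * (ln (1 + - v n) - - v n).
    rewrite /e /v /w r2; field.
    by rewrite MR gt_eqF.
  apply: (le_trans (ler_normD _ _)); rewrite !normrM !normr_nat.
  apply: lerD.
    apply: (@le_trans _ _ ((K n)%:R * (2 * `|w n| ^+ 3))).
      by rewrite ler_wpM2l// ln1D_taylor2.
    rewrite /w normrM normfV (gtr0_norm (r0 n)) r2.
    by rewrite le_eqVlt; apply/orP; left; apply/eqP; field; rewrite gt_eqF.
  apply: (@le_trans _ _ ((M n)%:R * (2 * (- v n) ^+ 2))).
    by rewrite ler_wpM2l// ln1D_taylor1.
  by rewrite /v /w r2 le_eqVlt; apply/orP; left; apply/eqP; field; rewrite MR gt_eqF.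
have e_cvg : e n @[n --> \oo] --> (- (x ^+ 2) / 2 : R).
  apply/cvgrPdist_le => eps eps0; near=> n.
  rewrite distrC (@le_trans _ _ (b n))//; first by near: n.
  rewrite (le_trans (ler_norm _))//; near: n.
  by move: eps eps0; apply/cvgr0Pnorm_le.
have : expR (e n) @[n --> \oo] --> (expR (- (x ^+ 2) / 2) : R).
  by apply: (cvg_comp _ _ e_cvg); exact: continuous_expR.
(* Once [w n] and [v n] are at most 1/2 in absolute value, both bases are positive and the
   exponential of [e n] is the kernel. *)
apply: cvg_trans; apply: near_eq_cvg; near=> n.
have w2n : `|w n| <= 2^-1 by near: n.
have v2n : `|v n| <= 2^-1 by near: n.
rewrite /e expRD !expRM_natl !lnK// posrE.
  by move: v2n; rewrite ler_norml; lra.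
by move: w2n; rewrite ler_norml; lra.
Unshelve. all: by end_near. Qed.

End beta_kernel.

(** * From beta integrals to the normal limit *)

Section binomial_clt.
Context {R : realType}.
Notation mu := (@lebesgue_measure R).

Lemma integral_is_derive (f F : R -> R) (a b : R) : a < b ->
  continuous f -> (forall x : R, is_derive x 1 F (f x)) ->
  (\int[mu]_(x in `[a, b]) (f x)%:E = (F b - F a)%:E)%E.
Proof.
move=> ab cf dF; rewrite EFinB.
have cF : continuous F.
  by move=> x; apply/differentiable_continuous/derivable1_diffP; have [] := dF x.
apply: continuous_FTC2 => //.
- exact: continuous_subspaceT.
- split.
  + by move=> x _; have [] := dF x.
  + by apply: cvg_at_right_filter; exact: cF.
  + by apply: cvg_at_left_filter; exact: cF.
- by move=> x _; rewrite derive1E; have [_ ->] := dF x.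
Qed.

(** By symmetry the half-line suffices, and there the function is a multiple of an exponential
    density. *)
Lemma integrable_expRN_norm (c : R) : 0 < c ->
  mu.-integrable setT (fun x => (expR (1 - c * `|x|))%:E).
Proof.
move=> c0.
have cg : continuous (fun x : R => expR (1 - c * `|x|)).
  move=> x; apply: continuous_comp; last exact: continuous_expR.
  apply: (@cvgB _ R^o); first exact: cvg_cst.
  by apply: (@cvgM R R); [exact: cvg_cst|exact: (@norm_continuous _ R^o)].
apply/integrableP; split.
  by apply/measurable_EFinP; exact: continuous_measurable_fun.
under eq_integral do rewrite /= ger0_norm ?expR_ge0//.
rewrite ge0_symfun_integralT//; last by move=> x /=; rewrite normrN.
have mD : measurable [set x : R | 0 <= x] by rewrite -set_itvcy.
rewrite lte_mul_pinfty//.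
have /integrableP[_] : mu.-integrable [set x : R | 0 <= x]
    (fun x => (expR 1 / c)%:E * (exponential_pdf c x)%:E)%E.
  apply: integrableZl => //; apply: (integrableS measurableT) => //.
  exact: integrable_exponential_pdf.
apply: le_lt_trans; rewrite le_eqVlt; apply/orP; left; apply/eqP.
apply: eq_integral => x; rewrite inE /= => x0.
rewrite exponential_pdfE// (ger0_norm x0)/= ger0_norm.
  by rewrite expRD mulrA divfK ?gt_eqF// mulNr.
by rewrite !mulr_ge0 ?expR_ge0 ?invr_ge0// ltW.
Qed.

Lemma continuous_beta_kernel K M (rho : R) :
  continuous (fun z : R => beta_kernel K M (- z / rho)).
Proof.
have cw (c : R) : continuous (fun z : R => 1 + c * (- z / rho) : R).
  move=> z; apply: (@cvgD _ R^o); first exact: cvg_cst.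
  apply: (@cvgM R R); first exact: cvg_cst.
  apply: (@cvgM R R); last exact: cvg_cst.
  by apply: (@cvgN _ R^o); exact: cvg_id.
move=> z; apply: (@cvgM R R).
  apply: (@continuous_comp _ _ _ (fun z : R => 1 + - z / rho) (fun y : R => y ^+ K)).
    by have := cw 1 z; under [X in continuous_at _ X]eq_fun do rewrite mul1r.
  exact: exprn_continuous.
apply: (@continuous_comp _ _ _ (fun z : R => 1 - K%:R / M%:R * (- z / rho))
  (fun y : R => y ^+ M)); last exact: exprn_continuous.
have := cw (- (K%:R / M%:R)) z.
by under [X in continuous_at _ X]eq_fun do rewrite mulNr.
Qed.

(** The substitution [p = K / (K + M) * (1 - x / rho)] turns the kernel, up to a constant, into the
    derivative of the binomial distribution function. The lower endpoint corresponds to [p = 1],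
    where that function vanishes. The constant stays implicit: total mass determines its limit
    later. *)
Lemma integral_beta_kernel K M (rho : R) : (0 < K)%N -> (0 < M)%N -> 0 < rho ->
  exists2 c : R, 0 < c & forall z, - (rho * (M%:R / K%:R)) < z ->
    (\int[mu]_(x in `[(- (rho * (M%:R / K%:R)))%R, z])
        (beta_kernel K M (- x / rho)%R)%:E =
     (c * binomial_cdf (K + M).+1 K.+1
            (K%:R / (K + M)%:R * (1 - z / rho)))%R%:E)%E.
Proof.
move=> K0 M0 rho0.
have KR : 0 < K%:R :> R by rewrite ltr0n.
have MR : 0 < M%:R :> R by rewrite ltr0n.
have KMR : 0 < K%:R + M%:R :> R by rewrite addr_gt0.
pose u0 : R := K%:R / (K + M)%:R.
have u00 : 0 < u0 by rewrite /u0 natrD divr_gt0.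
have u0E : 1 - u0 = M%:R / (K + M)%:R.
  by rewrite /u0 natrD; field; rewrite gt_eqF.
have u01 : 0 < 1 - u0 by rewrite u0E natrD divr_gt0.
pose A : R := (K.+1 * 'C((K + M).+1, K.+1))%:R.
have A0 : 0 < A by rewrite ltr0n muln_gt0 /= bin_gt0 ltnS leq_addr.
(* [c] is the derivative at [x = 0], where the kernel equals 1, of the binomial distribution
   function after the substitution. *)
pose c := A * (u0 ^+ K * (1 - u0) ^+ M) * (u0 / rho).
have c0 : 0 < c.
  apply: mulr_gt0; last by rewrite divr_gt0.
  by apply: mulr_gt0 => //; apply: mulr_gt0; exact: exprn_gt0.
exists c^-1; first by rewrite invr_gt0.
move=> z az.
pose G := c^-1 \*:
  (binomial_cdf (K + M).+1 K.+1 \o (fun x : R => u0 * (1 - x / rho))).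
have dG (x : R) : is_derive x 1 G (beta_kernel K M (- x / rho)).
  have dl : is_derive x 1 (fun x : R => u0 * (1 - x / rho)) (- (u0 / rho)).
    have H : is_derive x 1 (u0 \*: ((cst 1 : R -> R) - rho^-1 \*: (id : R -> R)))
        (u0 *: (0 - rho^-1 *: 1)).
      apply: is_deriveZ.
    rewrite /GRing.scale /= mulr1 sub0r mulrN in H.
    rewrite (_ : (fun x => _) =
      u0 \*: ((cst 1 : R -> R) - rho^-1 \*: (id : R -> R)))//.
    by apply/funext => y /=; rewrite /GRing.scale /= [y / _]mulrC.
  have db := @is_derive1_comp R _ (fun x : R => u0 * (1 - x / rho)) x _ _
    (is_derive_binomial_cdf (K + M).+1 K (u0 * (1 - x / rho))) dl.
  apply: is_derive_eq.
  rewrite /GRing.scale /= subSS addKn -/A /beta_kernel.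
  have -> : 1 - u0 * (1 - x / rho) = (1 - u0) * (1 - K%:R / M%:R * (- x / rho)).
    by rewrite u0E /u0 natrD; field; rewrite !gt_eqF.
  rewrite (exprMn K u0) (exprMn M (1 - u0)).
  rewrite (_ : 1 + - x / rho = 1 - x / rho); last by rewrite mulNr.
  have uK0 : u0 ^+ K != 0 by rewrite gt_eqF ?exprn_gt0.
  have uM0 : (1 - u0) ^+ M != 0 by rewrite gt_eqF ?exprn_gt0.
  have uN0 : u0 != 0 by rewrite gt_eqF.
  have rhoN0 : rho != 0 by rewrite gt_eqF.
  have AN0 : A != 0 by rewrite gt_eqF.
  rewrite /c; clear -uK0 uM0 uN0 rhoN0 AN0.
  move: ((1 - x / rho) ^+ K) ((1 - K%:R / M%:R * (- x / rho)) ^+ M) => y1 y2.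
  move: u0 A (u0 ^+ K) ((1 - u0) ^+ M) uK0 uM0 uN0 AN0 => u' A' v1 v2 *.
  by field; apply/and5P.
rewrite (@integral_is_derive _ G _ _ az _ dG); last exact: continuous_beta_kernel.
congr EFin; rewrite /G /= /GRing.scale /=.
have -> : u0 * (1 - - (rho * (M%:R / K%:R)) / rho) = 1.
  by rewrite /u0 natrD; field; rewrite !gt_eqF.
by rewrite binomial_cdf_at1 ?mulr0 ?subr0// ltnS leq_addr.
Qed.

(** Dominated convergence is applied twice. Over the whole line it shows that the normalising
    constants [e n] tend to 1, as the binomial distribution function is 1 at [p = 0]; over []-oo,
    z]] it gives the limit of [e n * G n]. Dividing yields the claim without Stirling's formula. *)
Lemma binomial_cdf_cvg_normal (sigma : R) (K M : nat -> nat) (z : R) :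
  0 < sigma -> (forall n, 0 < K n)%N -> (forall n, 0 < M n)%N ->
  (K n)%:R @[n --> \oo] --> (+oo : set_system R) ->
  (K n)%:R / (M n)%:R @[n --> \oo] --> (0 : R) ->
  binomial_cdf (K n + M n).+1 (K n).+1
      ((K n)%:R / (K n + M n)%:R * (1 - z / (sigma * Num.sqrt (K n)%:R)))
    @[n --> \oo] --> (fine (normal_prob 0 sigma `]-oo, z]%classic) : R).
Proof.
move=> sigma0 K0 M0 Ky KM0.
have sN0 : sigma != 0 by rewrite gt_eqF.
pose rho n := sigma * Num.sqrt (K n)%:R : R.
have rho0 n : 0 < rho n by rewrite mulr_gt0// sqrtr_gt0 ltr0n.
pose a n := - (rho n * ((M n)%:R / (K n)%:R)).
pose ker n (x : R) := beta_kernel (K n) (M n) (- x / rho n).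
(* On [D n] the success probability runs from 1, at [a n], down to 0, at [rho n]; the kernel is cut
   off outside, where it need not be dominated. *)
pose D n := `[a n, rho n]%classic.
pose F n := (fun x => normal_peak sigma * ker n x) \_ (D n).
have KR n : 0 < (K n)%:R :> R by rewrite ltr0n.
have MR n : 0 < (M n)%:R :> R by rewrite ltr0n.
have peak0 := normal_peak_gt0 sN0.
have a0 n : a n < 0 by rewrite oppr_lt0 mulr_gt0// divr_gt0.
have sqrty : Num.sqrt (K n)%:R @[n --> \oo] --> (+oo : set_system R).
  exact: sqrtr_cvgy.
have rhoy : rho n @[n --> \oo] --> (+oo : set_system R).
  apply/cvgryPge => A; move/cvgryPge: sqrty => /(_ (A / sigma)).
  by apply: filterS => n; rewrite ler_pdivrMr// mulrC.
have MKy : (M n)%:R / (K n)%:R @[n --> \oo] --> (+oo : set_system R).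
  apply/gtr0_cvgV0; first by near=> n; rewrite divr_gt0.
  apply: (cvg_trans _ KM0); apply: near_eq_cvg; near=> n.
  by rewrite /= invf_div.
have in_D (x : R) : \forall n \near \oo, a n < x < rho n.
  near=> n; apply/andP; split; last first.
    by near: n; move/cvgryPgt: rhoy; exact.
  rewrite ltrNl (@lt_le_trans _ _ (rho n))//.
    by near: n; move/cvgryPgt: rhoy; exact.
  rewrite ler_peMr//; first exact: ltW.
  by near: n; move/cvgryPge: MKy; exact.
have mker n : measurable_fun setT (fun x => normal_peak sigma * ker n x).
  apply: measurable_funM => //.
  by apply: continuous_measurable_fun; exact: continuous_beta_kernel.
have mD n : measurable (D n) by exact: measurable_itv.
have mF n : measurable_fun setT (EFin \o F n).
  apply/measurable_EFinP/(measurable_restrict _ (mD n)) => //.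
  exact: measurable_funTS.
have F_cvg (x : R) : (F n x)%:E @[n --> \oo] --> (normal_pdf 0 sigma x)%:E.
  apply: cvg_EFin; first by near=> n.
  have H := @beta_kernel_cvg R K M (- x / sigma) K0 M0 Ky KM0.
  have := cvgM (@cvg_cst _ (normal_peak sigma) _ _ _) H.
  rewrite normal_pdfE//= /normal_fun subr0.
  rewrite (_ : - (- x / sigma) ^+ 2 / 2 = - x ^+ 2 / (sigma ^+ 2 *+ 2)); last first.
    by rewrite -mulr_natr; field.
  move=> /(_ _ _); apply: cvg_trans; apply: near_eq_cvg; near=> n.
  have /andP[ax xr] : a n < x < rho n by near: n; exact: in_D.
  rewrite /= /F patchE ifT; last by rewrite inE /D /= in_itv /= !ltW.
  by congr (_ * beta_kernel _ _ _); rewrite /rho invfM mulrA.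
(* For [w = - x / rho n] the factor [sqrt K] in the bound of [beta_kernel_le] cancels against
   [rho n], so that [g] is the same for all [n]. *)
pose g (x : R) := normal_peak sigma * expR (1 - (2 * sigma)^-1 * `|x|).
have ig : mu.-integrable setT (EFin \o g).
  rewrite (_ : EFin \o g = (fun x => (normal_peak sigma)%:E *
     (expR (1 - (2 * sigma)^-1 * `|x|))%:E)%E)//.
  apply: integrableZl => //; apply: integrable_expRN_norm.
  by rewrite invr_gt0 mulr_gt0.
have w_bounds n x : D n x ->
    -1 <= - x / rho n /\ (K n)%:R / (M n)%:R * (- x / rho n) <= 1.
  rewrite /D /= in_itv /= => /andP[ax xr]; split.
    by rewrite mulNr lerN2 ler_pdivrMr// mul1r.
  rewrite mulrA ler_pdivrMr// mul1r -ler_pdivlMl ?divr_gt0//.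
  by rewrite invf_div lerNl mulrC.
have Fg n x : `|F n x| <= g x.
  rewrite /F patchE; case: ifPn => [|_]; last first.
    by rewrite normr0 mulr_ge0 ?expR_ge0 ?ltW.
  rewrite inE => /w_bounds[w1 w2].
  rewrite ger0_norm; last by rewrite mulr_ge0 ?beta_kernel_ge0// ltW.
  rewrite ler_pM2l//; apply: (le_trans (beta_kernel_le _ _ _ _)) => //.
  rewrite ler_expR lerD2l lerN2 normrM normrN normfV (gtr0_norm (rho0 n)).
  rewrite /rho le_eqVlt; apply/orP; left; apply/eqP; field.
  by rewrite sN0 gt_eqF// sqrtr_gt0.
have int_cvg (A : set R) : measurable A ->
    (\int[mu]_(x in A) (F n x)%:E)%E @[n --> \oo] --> normal_prob 0 sigma A.
  move=> mA; apply: (@dominated_cvg _ _ _ mu A mA _ _ (EFin \o g)) => //.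
  - by move=> n; apply: measurable_funTS; exact: mF.
  - exact: (integrableS measurableT).
  - by move=> n x _ /=; rewrite lee_fin.
have [c /all_and2[c0 cE]] : {c : nat -> R & forall n, 0 < c n /\
  forall z, a n < z -> (\int[mu]_(x in `[a n, z]) (ker n x)%:E =
     (c n * binomial_cdf (K n + M n).+1 (K n).+1
            ((K n)%:R / (K n + M n)%:R * (1 - z / rho n)))%R%:E)%E}.
  apply: (@choice _ _ (fun n cn => 0 < cn /\ forall z, a n < z ->
   (\int[mu]_(x in `[a n, z]) (ker n x)%:E =
     (cn * binomial_cdf (K n + M n).+1 (K n).+1
            ((K n)%:R / (K n + M n)%:R * (1 - z / rho n)))%R%:E)%E)) => n.
  by have [cn cn0 H] := integral_beta_kernel (K0 n) (M0 n) (rho0 n); exists cn.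
have ker0 n x : D n x -> 0 <= ker n x.
  by move=> Dx; apply: beta_kernel_ge0; have [] := w_bounds n x Dx.
have intF n (A : set R) : measurable A ->
    (\int[mu]_(x in A) (F n x)%:E)%E =
    ((normal_peak sigma)%:E * \int[mu]_(x in A `&` D n) (ker n x)%:E)%E.
  move=> mA; rewrite -ge0_integralZl_EFin ?ltW//; last 3 first.
  - by apply: measurableI => //; exact: mD.
  - by move=> x [_ Dx]; rewrite lee_fin ker0.
  - apply/measurable_EFinP; apply: measurable_funTS.
    by apply: continuous_measurable_fun; exact: continuous_beta_kernel.
  rewrite integral_mkcondr; apply: eq_integral => x _.
  by rewrite /F !patchE; case: ifP.
pose G n := binomial_cdf (K n + M n).+1 (K n).+1
  ((K n)%:R / (K n + M n)%:R * (1 - z / rho n)).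
pose e n := normal_peak sigma * c n.
have e1 : (e n)%:E @[n --> \oo] --> 1%:E.
  have := int_cvg setT measurableT; rewrite probability_setT.
  apply: cvg_trans; apply: near_eq_cvg; near=> n.
  rewrite intF// setTI cE; last by rewrite (lt_trans (a0 n)).
  by rewrite divff ?gt_eqF// subrr mulr0 binomial_cdf_at0 mulr1.
have mz : measurable (`]-oo, z]%classic : set R) by exact: measurable_itv.
have eG : (e n * G n)%:E @[n --> \oo] --> normal_prob 0 sigma `]-oo, z]%classic.
  have := int_cvg `]-oo, z]%classic mz.
  apply: cvg_trans; apply: near_eq_cvg; near=> n.
  have /andP[az zr] : a n < z < rho n by near: n; exact: in_D.
  rewrite intF//.
  rewrite (_ : _ `&` _ = `[a n, z]%classic).
    by rewrite cE// -EFinM mulrA.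
  apply/seteqP; split => x; rewrite /D /= !in_itv/=.
    by move=> [-> /andP[->]].
  by move=> /andP[-> xz]; rewrite xz (le_trans xz)// ltW.
have fin : normal_prob 0 sigma `]-oo, z]%classic \is a fin_num.
  by rewrite fin_num_measure.
move: e1 => /fine_cvgP[_ /= e1].
have {}eG : e n * G n @[n --> \oo] -->
    (fine (normal_prob 0 sigma `]-oo, z]%classic) : R).
  by move: eG; rewrite -{1}(fineK fin) => /fine_cvgP[_ /=].
have := cvgM (cvgV (oner_neq0 _) e1) eG.
rewrite invr1 mul1r => /(_ _ _ _); apply: cvg_trans.
apply: near_eq_cvg; near=> n => /=.
by rewrite /= mulKf// gt_eqF// /e mulr_gt0.
Unshelve. all: by end_near. Qed.

End binomial_clt.

(** * Exceedance probabilities *)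

Section log_quantile.
Context {R : realType}.

(** As [r n * x n] converges and [r n] diverges, [x n] tends to 0; the error of linearising the
    logarithm is then at most [2 * |r n * x n| * |x n|]. *)
Lemma cvg_mul_ln1D (r x : nat -> R) (l : R) :
  r n @[n --> \oo] --> (+oo : set_system R) ->
  r n * x n @[n --> \oo] --> l ->
  r n * ln (1 + x n) @[n --> \oo] --> l.
Proof.
move=> ry rx.
have rV0 : (r n)^-1 @[n --> \oo] --> (0 : R).
  apply/gtr0_cvgV0 => //; near=> n.
  by near: n; move/cvgryPgt: ry; exact.
have x0 : x n @[n --> \oo] --> (0 : R).
  rewrite -[0](mulr0 l); apply: cvg_trans (cvgM rx rV0).
  apply: near_eq_cvg; near=> n; rewrite /= mulrAC mulfV ?mul1r// gt_eqF//.
  by near: n; move/cvgryPgt: ry; exact.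
have b0 : 2 * (`|r n * x n| * `|x n|) @[n --> \oo] --> (0 : R).
  have /(_ _ _ _) H := cvgM (cvg_norm rx) (cvg_norm x0).
  have /(_ _ _) := cvgM (@cvg_cst _ (2 : R) nat \oo _) H.
  by rewrite normr0 !mulr0; exact.
have half0 : 0 < 2^-1 :> R by rewrite invr_gt0.
have d0 : r n * ln (1 + x n) - r n * x n @[n --> \oo] --> (0 : R).
  apply/cvgr0Pnorm_le => eps eps0; near=> n.
  apply: (@le_trans _ _ (2 * (`|r n * x n| * `|x n|))); last first.
    rewrite -[leLHS]ger0_norm ?mulr_ge0//.
    by near: n; move/cvgr0Pnorm_le: b0; exact.
  have -> : 2 * (`|r n * x n| * `|x n|) = `|r n| * (2 * x n ^+ 2).
    have -> : x n ^+ 2 = `|x n| ^+ 2 by rewrite real_normK ?num_real.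
    by rewrite normrM; ring.
  rewrite -mulrBr normrM ler_wpM2l// ln1D_taylor1//.
  by near: n; move/cvgr0Pnorm_le: x0; exact.
have := cvgD d0 rx; rewrite add0r => /(_ _); apply: cvg_trans.
by apply: near_eq_cvg; near=> n; rewrite /= subrK.
Unshelve. all: by end_near. Qed.

(** The function [ln q + gamma ln] has derivative [Delta / u], so Cauchy's mean value theorem
    against [ln] makes the ratio of increments a value of [Delta], which is small near 0. Uniformity
    in [a] and [b] allows both to vary with [n]. *)
Lemma log_quantile_increment (E : Type) (q : R -> E -> R) (gamma : E -> R)
    (t : E) : condition_A q gamma t -> (forall a, 0 < a < 1 -> 0 < q a t) ->
  forall eta, 0 < eta -> \forall d \near 0^'+,
    forall a b, 0 < a < d -> 0 < b < d ->
    `|ln (q b t) - ln (q a t) + gamma t * (ln b - ln a)| <= eta * `|ln b - ln a|.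
Proof.
move=> [dq _ D0] q0 eta eta0.
have := D0; move=> /cvgr0Pnorm_le /(_ _ eta0) /= nD.
have [e /= e0 De] : exists2 e, 0 < e &
    forall c, 0 < c < e -> `|Delta q gamma t c| <= eta.
  case: nD => e /= e0 De; exists e => // c /andP[c0 ce].
  by apply: De => //; rewrite /= sub0r normrN gtr0_norm.
near=> d => a b.
(* Both sides are unchanged when [a] and [b] are exchanged. *)
wlog ab : a b / a < b.
  move=> H; have [|ba|->] := ltgtP a b; first exact: H.
    move=> ad bd; have := H _ _ ba bd ad.
    rewrite -normrN opprD opprB -mulrN opprB => /le_trans; apply.
    by rewrite -(opprB (ln b)) normrN.
  by rewrite !subrr mulr0 addr0 normr0 mulr0.
move=> /andP[a0 ad] /andP[b0 bd].
have d1 : d < 1 by near: d; exact: nbhs_right_lt.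
have de : d < e by near: d; exact: nbhs_right_lt.
pose f u := ln (q u t) + gamma t * ln u.
pose df u := Delta q gamma t u / u.
have dfE (u : R) : a <= u <= b -> is_derive u 1 f (df u).
  move=> /andP[au ub].
  have u0 : 0 < u by exact: lt_le_trans au.
  have u1 : 0 < u < 1 by rewrite u0 (le_lt_trans ub)// (lt_trans bd).
  have dlq : derivable (fun b => ln (q b t)) u 1.
    have dql : is_derive (q u t) 1 (@ln R) (q u t)^-1.
      by apply: is_derive1_ln; exact: q0.
    have dqu : is_derive u 1 (fun b => q b t) ('D_1 (fun b => q b t) u).
      by apply: DeriveDef => //; exact: dq.
    by have [] := is_derive1_comp dql dqu.
  have H1 : is_derive u 1 (fun b => ln (q b t)) (derive1 (fun b => ln (q b t)) u).
    by rewrite derive1E; apply: DeriveDef.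
  have H2 : is_derive u 1 (@ln R) u^-1 by exact: is_derive1_ln.
  have H : is_derive u 1 ((fun b => ln (q b t)) + gamma t \*: (@ln R))
     (derive1 (fun b => ln (q b t)) u + gamma t *: u^-1).
    apply: is_deriveD.
  apply: is_derive_eq.
  rewrite /df /Delta /GRing.scale /=; field; lra.
have dgE (u : R) : a <= u <= b -> is_derive u 1 (@ln R) u^-1.
  by move=> /andP[au ub]; apply: is_derive1_ln; exact: lt_le_trans au.
have cont (h dh : R -> R) : (forall u, a <= u <= b -> is_derive u 1 h (dh u)) ->
    {within `[a, b], continuous h}.
  move=> H; apply: derivable_within_continuous => u.
  by rewrite in_itv/= => /H[].
have [|||||c] := @cauchy_MVT R f df (@ln R) (fun u => u^-1) a b ab.
- exact: (cont _ df).
- exact: (cont _ (fun u => u^-1)).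
- by move=> u; rewrite in_itv/= => /andP[au ub]; apply: dfE; rewrite !ltW.
- by move=> u; rewrite in_itv/= => /andP[au ub]; apply: dgE; rewrite !ltW.
- move=> u; rewrite in_itv/= => /andP[au ub].
  by rewrite invr_eq0 gt_eqF// (lt_trans a0).
rewrite in_itv/= => /andP[ac cb].
have c0 : 0 < c by exact: lt_trans ac.
have lab : ln b - ln a != 0 by rewrite subr_eq0 gt_eqF// ltr_ln ?posrE.
have -> : df c / c^-1 = Delta q gamma t c.
  by rewrite /df invrK divfK// gt_eqF.
move=> HD.
have -> : ln (q b t) - ln (q a t) + gamma t * (ln b - ln a) = f b - f a.
  by rewrite /f; ring.
rewrite -[f b - f a](divfK lab) -HD normrM ler_wpM2r// De//.
by rewrite c0 (lt_trans cb)// (lt_trans bd).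
Unshelve. all: by end_near. Qed.

End log_quantile.

(** * Ranks and enclosing success probabilities at an intermediate order *)

Section intermediate_order.
Context {R : realType}.
Variables (m : nat -> nat) (a : nat -> R).
Local Notation s n := ((m n)%:R * a n).
Local Notation r n := (Num.sqrt (s n)).
Local Notation k n := (Num.truncn (s n)).

(* For the rank k = truncn (m a), these are eventually k - 1 and m - k; the
   maximum with 1 makes them positive for every n. *)
Definition below_rank n : nat := maxn 1 (k n).-1.
Definition above_rank n : nat := maxn 1 (m n - k n).

Local Notation K := below_rank.
Local Notation M := above_rank.
Hypothesis a01 : forall n, 0 < a n < 1.
Hypothesis a_cvg0 : a n @[n --> \oo] --> (0 : R).
Hypothesis s_cvgy : s n @[n --> \oo] --> (+oo : set_system R).

(** Eventually [s n >= 2], hence [k >= 2], and [a n < 1] gives [k < m]; the maxima with 1 are then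
    inactive. *)
Lemma intermediate_ranks : \forall n \near \oo,
  [/\ (k n).-1 = K n, m n = (K n + M n).+1, k n = (K n).+1,
     s n - 2 < (K n)%:R & (K n)%:R <= s n - 1].
Proof.
near=> n.
have s2 : 2 <= s n by near: n; move/cvgryPge: s_cvgy; exact.
have /andP[a0 a1] := a01 n.
have s0 : 0 <= s n by lra.
have /andP[ks sk] := truncn_itv s0.
have k2 : (2 <= k n)%N by rewrite truncn_ge_nat.
have km : (k n < m n)%N.
  rewrite -(ltr_nat R) (le_lt_trans ks)// -[ltRHS]mulr1 ltr_pM2l//.
  rewrite ltr0n lt0n; apply/eqP => m0.
  by move: s2; rewrite m0 mul0r; lra.
have KE : K n = (k n).-1 by rewrite /below_rank; apply/maxn_idPr; lia.
have ME : M n = (m n - k n)%N by rewrite /above_rank; apply/maxn_idPr; lia.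
have kE : k n = (K n).+1 by lia.
split=> //; [lia| |].
- by move: sk; rewrite kE -!natr1; move: (s n) (K n)%:R => u v; lra.
- by move: ks; rewrite kE -natr1; move: (s n) (K n)%:R => u v; lra.
Unshelve. all: by end_near. Qed.

Lemma intermediate_rank_cvgy : (K n)%:R @[n --> \oo] --> (+oo : set_system R).
Proof.
apply/cvgryPge => A; near=> n.
have : A + 2 <= s n by near: n; move/cvgryPge: s_cvgy; exact.
have [_ _ _ + _] : [/\ (k n).-1 = K n, m n = (K n + M n).+1, k n = (K n).+1,
     s n - 2 < (K n)%:R & (K n)%:R <= s n - 1].
  by near: n; exact: intermediate_ranks.
lra.
Unshelve. all: by end_near. Qed.

Lemma intermediate_rank_ratio_cvg0 :
  (K n)%:R / (M n)%:R @[n --> \oo] --> (0 : R).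
Proof.
apply/cvgr0Pnorm_le => eps eps0; near=> n.
have [_ mE _ K1 K2] : [/\ (k n).-1 = K n, m n = (K n + M n).+1, k n = (K n).+1,
     s n - 2 < (K n)%:R & (K n)%:R <= s n - 1].
  by near: n; exact: intermediate_ranks.
have MR : 0 < (M n)%:R :> R by rewrite ltr0n /above_rank leq_max.
have /andP[a0 a1] := a01 n.
have a2 : a n <= 2^-1.
  by near: n; move: a_cvg0 => /cvgr_le; apply; rewrite invr_gt0.
have ae : a n <= eps / 2.
  by near: n; move: a_cvg0 => /cvgr_le; apply; rewrite divr_gt0.
have mR : (m n)%:R = (K n)%:R + (M n)%:R + 1 :> R.
  by rewrite mE -addn1 !natrD.
rewrite ger0_norm ?divr_ge0// ler_pdivrMr//.
(* From [K <= a * (K + M + 1) - 1] and [a <= 1/2] follows [K <= 2 * a * M]. *)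
move: K1 K2; rewrite mR; have : 0 <= (K n)%:R :> R by []; nra.
Unshelve. all: by end_near. Qed.

Variable sigma : R.
Hypothesis sigma0 : 0 < sigma.

(* The argument of the binomial cdf in binomial_cdf_cvg_normal *)
Definition bracket (y : R) n : R := (K n)%:R / (K n + M n)%:R *
  (1 - y / (sigma * Num.sqrt (K n)%:R)).

Let r_cvgy : r n @[n --> \oo] --> (+oo : set_system R).
Proof. exact: sqrtr_cvgy. Qed.

Let rV_cvg0 : (r n)^-1 @[n --> \oo] --> (0 : R).
Proof.
apply/gtr0_cvgV0 => //; near=> n.
by near: n; move/cvgryPgt: r_cvgy; exact.
Unshelve. all: by end_near. Qed.

(** The quotient [bracket y n / a n] is [U n * (1 - y / sigma * v n / r n)]. Here [U n - 1] is of
    order [1 / s n], negligible on the scale [r n], and [v n] tends to 1. *)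
Lemma bracket_relative_cvg y :
  r n * (bracket y n / a n - 1) @[n --> \oo] --> (- (y / sigma) : R).
Proof.
pose U n : R := (K n)%:R / (K n + M n)%:R / a n.
pose v n : R := r n / Num.sqrt (K n)%:R.
(* Since [K + M = m - 1], the denominator is [s - a]; [K] is within 2 of it and [s - a >= s / 2],
   whence the constant 4. *)
have U1 : \forall n \near \oo, `|U n - 1| <= 4 * (r n)^-1 * (r n)^-1.
  near=> n.
  have [_ mE _ K1 K2] : [/\ (k n).-1 = K n, m n = (K n + M n).+1, k n = (K n).+1,
     s n - 2 < (K n)%:R & (K n)%:R <= s n - 1].
    by near: n; exact: intermediate_ranks.
  have /andP[a0 a1] := a01 n.
  have s2 : 2 <= s n by near: n; move/cvgryPge: s_cvgy; exact.
  have KMR : (K n + M n)%:R = (m n)%:R - 1 :> R by rewrite mE -addn1 !natrD; ring.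
  have KM0 : 0 < (K n + M n)%:R * a n.
    by rewrite mulr_gt0// ltr0n addn_gt0 /below_rank leq_max.
  have KMs : (K n + M n)%:R * a n = s n - a n by rewrite KMR; ring.
  have -> : U n - 1 = ((K n)%:R - s n + a n) / (s n - a n).
    rewrite /U -mulrA -invfM KMs; field; rewrite -KMs gt_eqF//.
  rewrite -mulrA -invfM -expr2 sqr_sqrtr; last lra.
  rewrite normrM normfV (@gtr0_norm _ (s n - a n)) -?KMs// KMs.
  rewrite ler_pdivrMr; last lra.
  rewrite mulrAC ler_pdivlMr; last lra.
  have : `|(K n)%:R - s n + a n| <= 2 by rewrite ler_norml; lra.
  nra.
have rU : r n * (U n - 1) @[n --> \oo] --> (0 : R).
  apply/cvgr0Pnorm_le => eps eps0; near=> n.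
  have r0 : 0 < r n by near: n; move/cvgryPgt: r_cvgy; exact.
  have : `|U n - 1| <= 4 * (r n)^-1 * (r n)^-1 by near: n.
  have : `|(r n)^-1| <= eps / 4.
    by near: n; move/cvgr0Pnorm_le: rV_cvg0; apply; rewrite divr_gt0.
  rewrite gtr0_norm ?invr_gt0// => re Ue; rewrite normrM (gtr0_norm r0).
  apply: (@le_trans _ _ (r n * (4 * (r n)^-1 * (r n)^-1))).
    by rewrite ler_pM2l.
  have -> : r n * (4 * (r n)^-1 * (r n)^-1) = 4 * (r n)^-1.
    by field; rewrite gt_eqF.
  lra.
have U_cvg1 : U n @[n --> \oo] --> (1 : R).
  have /(_ _ _) := cvgM rV_cvg0 rU; rewrite mul0r => H.
  have /(_ _ _) := cvgD H (@cvg_cst _ (1 : R) nat \oo _); rewrite add0r.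
  apply: cvg_trans; apply: near_eq_cvg; near=> n.
  have r0 : 0 < r n by near: n; move/cvgryPgt: r_cvgy; exact.
  have E : (r n)^-1 * (r n * (U n - 1)) + 1 = U n.
    by rewrite mulKf ?subrK// gt_eqF.
  exact: E.
have v_cvg1 : v n @[n --> \oo] --> (1 : R).
  have KV0 : 1 + 2 * (K n)%:R^-1 @[n --> \oo] --> (1 : R).
    have H : (K n)%:R^-1 @[n --> \oo] --> (0 : R).
      apply/gtr0_cvgV0; last exact: intermediate_rank_cvgy.
      by near=> n; rewrite ltr0n /below_rank leq_max.
    have /(_ _ _) H2 := cvgM (@cvg_cst _ (2 : R) nat \oo _) H.
    have /(_ _ _) := cvgD (@cvg_cst _ (1 : R) nat \oo _) H2.
    by rewrite mulr0 addr0; exact.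
  (* The squeeze is [1 <= v <= v ^+ 2 = s / K <= 1 + 2 / K]. *)
  apply: (squeeze_cvgr _ (@cvg_cst _ (1 : R) nat \oo _) KV0); near=> n.
  have [_ _ _ K1 K2] : [/\ (k n).-1 = K n, m n = (K n + M n).+1, k n = (K n).+1,
     s n - 2 < (K n)%:R & (K n)%:R <= s n - 1].
    by near: n; exact: intermediate_ranks.
  have K0 : 0 < (K n)%:R :> R by rewrite ltr0n /below_rank leq_max.
  have sK0 : 0 < Num.sqrt (K n)%:R :> R by rewrite sqrtr_gt0.
  have v1 : 1 <= v n.
    by rewrite /v ler_pdivlMr// mul1r ler_wsqrtr//; lra.
  rewrite v1 /=; apply: (@le_trans _ _ (v n ^+ 2)).
    by rewrite expr2 ler_peMr// (le_trans ler01).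
  have -> : v n ^+ 2 = s n / (K n)%:R.
    by rewrite /v expr_div_n !sqr_sqrtr ?ltW//; lra.
  rewrite ler_pdivrMr// mulrDl mul1r -mulrA mulVf ?gt_eqF//; lra.
have /(_ _) H1 := cvgM U_cvg1 v_cvg1.
have /(_ _ _) H2 := cvgM H1 (@cvg_cst _ (y / sigma : R) nat \oo _).
have /(_ _ _) := cvgB rU H2.
rewrite mulr1 mul1r sub0r; apply: cvg_trans; apply: near_eq_cvg; near=> n.
have K0 : 0 < (K n)%:R :> R by rewrite ltr0n /below_rank leq_max.
have sK0 : Num.sqrt (K n)%:R != 0 :> R by rewrite gt_eqF// sqrtr_gt0.
have /andP[a0 a1] := a01 n.
have E : r n * (U n - 1) - U n * v n * (y / sigma) = r n * (bracket y n / a n - 1).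
  have KM0 : (K n + M n)%:R != 0 :> R by rewrite pnatr_eq0 addn_eq0 /below_rank; lia.
  rewrite /bracket /U /v; move: (K n + M n)%:R KM0 => KM KM0; field.
  by rewrite sK0 KM0 !gt_eqF.
exact: E.
Unshelve. all: by end_near. Qed.

(** This coarse enclosure serves to keep the bracket inside []0, 1[], close to 0, and above the
    threshold of the oscillation. *)
Lemma bracket_near y : \forall n \near \oo, a n / 2 < bracket y n < 2 * a n.
Proof.
have rx := @bracket_relative_cvg y.
have x0 : bracket y n / a n - 1 @[n --> \oo] --> (0 : R).
  have /(_ _ _) := cvgM rV_cvg0 rx; rewrite mul0r.
  apply: cvg_trans; apply: near_eq_cvg; near=> n.
  have r0 : 0 < r n by near: n; move/cvgryPgt: r_cvgy; exact.
  have E : (r n)^-1 * (r n * (bracket y n / a n - 1)) = bracket y n / a n - 1.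
    by rewrite mulKf// gt_eqF.
  exact: E.
near=> n.
have /andP[an0 _] := a01 n.
have : `|bracket y n / a n - 1| <= 4^-1.
  by near: n; move/cvgr0Pnorm_le: x0; apply; rewrite invr_gt0.
rewrite ler_norml => /andP[h1 h2].
have /andP[] : 2^-1 < bracket y n / a n < 2 by lra.
by rewrite ltr_pdivlMr// ltr_pdivrMr// mulrC => -> ->.
Unshelve. all: by end_near. Qed.

Lemma bracket_ln_cvg y :
  r n * (ln (bracket y n) - ln (a n)) @[n --> \oo] --> (- (y / sigma) : R).
Proof.
have := cvg_mul_ln1D r_cvgy (@bracket_relative_cvg y).
apply: cvg_trans; apply: near_eq_cvg; near=> n.
have /andP[an0 _] := a01 n.
have /andP[b1 b2] : a n / 2 < bracket y n < 2 * a n.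
  by near: n; exact: bracket_near.
have b0 : 0 < bracket y n by lra.
by rewrite addrC subrK ln_div ?posrE.
Unshelve. all: by end_near. Qed.

Variables (E : Type) (q : R -> E -> R) (gamma : E -> R) (t : E).
Hypothesis condA : condition_A q gamma t.
Hypothesis q_gt0 : forall x a, 0 < a < 1 -> 0 < q a x.
Hypothesis gammaE : gamma t = sigma.

(** Up to the error [d n], the increment of [ln q] is [- gamma t] times that of [ln], which on the
    scale [r n] tends to [- (y / sigma)]; the factors [gamma t] and [sigma] cancel. *)
Lemma bracket_quantile_cvg y :
  r n * (ln (q (bracket y n) t) - ln (q (a n) t)) @[n --> \oo] --> y.
Proof.
pose l n := ln (bracket y n) - ln (a n).
have rl : r n * l n @[n --> \oo] --> (- (y / sigma) : R) by exact: bracket_ln_cvg.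
have rln : `|r n * l n| @[n --> \oo] --> `|- (y / sigma)| by exact: cvg_norm.
pose d n := ln (q (bracket y n) t) - ln (q (a n) t) + gamma t * l n.
have rd : r n * d n @[n --> \oo] --> (0 : R).
  apply/cvgr0Pnorm_le => eps eps0.
  (* [C] eventually bounds [|r n * l n|], so the precision [eps / C] makes the scaled error at most
     [eps]. *)
  pose C := `|y / sigma| + 1.
  have C0 : 0 < C by rewrite ltr_wpDl.
  have [c c0 Hc] : exists2 c : R, 0 < c & forall a b, 0 < a < c -> 0 < b < c ->
     `|ln (q b t) - ln (q a t) + gamma t * (ln b - ln a)| <=
       eps / C * `|ln b - ln a|.
    near (0 : R)^'+ => c; exists c; first by [].
    near: c; apply: log_quantile_increment => //; first exact: q_gt0.
    by rewrite divr_gt0.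
  near=> n.
  have /andP[an0 _] := a01 n.
  have /andP[b1 b2] : a n / 2 < bracket y n < 2 * a n.
    by near: n; exact: bracket_near.
  have ac : a n <= c / 3.
    by near: n; move: a_cvg0 => /cvgr_le; apply; rewrite divr_gt0.
  have dn : `|d n| <= eps / C * `|l n| by apply: Hc; lra.
  have rC : `|r n * l n| <= C.
    near: n; move: rln => /cvgr_le; apply.
    by rewrite normrN /C ltrDl.
  rewrite normrM (le_trans (ler_wpM2l (normr_ge0 _) dn))//.
  rewrite mulrCA -normrM mulrAC ler_pdivrMr// ler_pM2l//.
have gl : gamma t * (r n * l n) @[n --> \oo] --> gamma t * - (y / sigma).
  by apply: cvgM => //; exact: cvg_cst.
have /(_ _) := cvgB rd gl.
rewrite sub0r mulrN opprK gammaE mulrC divfK ?gt_eqF//.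
apply: cvg_trans; apply: near_eq_cvg; near=> n.
have e : r n * d n - sigma * (r n * l n) =
  r n * (ln (q (bracket y n) t) - ln (q (a n) t)).
  by rewrite /d gammaE; ring.
exact: e.
Unshelve. all: by end_near. Qed.

End intermediate_order.

(** As [F x (q b x) = 1 - b] and [F x] is nondecreasing, it suffices to compare the threshold with
    quantiles at [x]. For logarithms relative to [q (a n) t], on the scale [r n], the threshold sits
    near [y] and the quantiles near [y + eps] and [y - eps]. Three errors of at most [eps / 4]
    (linearised logarithm, limit at [t], passage from [t] to [x]) do not close the gap. *)
Lemma exceedance_bracket (R : realType) (E : Type)
    (F : E -> cumulativeBounded (0 : R) (1 : R)) (q : R -> E -> R)
    (gamma : E -> R) (t : E) (B : nat -> set E) (m : nat -> nat)
    (a : nat -> R) (delta y eps : R) :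
  let ma n := (m n)%:R * a n in
  is_quantile F q -> 0 < gamma t -> condition_A q gamma t ->
  (forall n, B n t) ->
  (forall n, 0 < a n < 1) -> a n @[n --> \oo] --> (0 : R) ->
  ma n @[n --> \oo] --> (+oo : set_system R) ->
  0 < delta ->
  ((ma n ^+ 2)%:E * oscillation q (B n) ((m n)%:R `^ (- (1 + delta))))%E
    @[n --> \oo] --> 0%E ->
  0 < eps ->
  \forall n \near \oo, forall x, B n x ->
    bracket m a (gamma t) (y + eps) n <=
      1 - F x (q (a n) t * (1 + y / Num.sqrt (ma n))) <=
    bracket m a (gamma t) (y - eps) n.
Proof.
move=> ma qF g0 cA Bt a01 a_cvg0 s_cvgy d0 /fine_cvgP[osc_fin osc_cvg] eps0.
pose r n := Num.sqrt (ma n).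
have q_gt0 x c : 0 < c < 1 -> 0 < q c x by move=> /(qF x)[].
have ry : r n @[n --> \oo] --> (+oo : set_system R) by exact: sqrtr_cvgy.
have rln : r n * ln (1 + y / r n) @[n --> \oo] --> y.
  apply: cvg_mul_ln1D => //.
  have /(_ _) := @cvg_cst R y nat \oo.
  apply: cvg_trans; apply: near_eq_cvg; near=> n.
  rewrite /= mulrC divfK// gt_eqF//.
  by near: n; move/cvgryPgt: ry; exact.
pose mV n : R := (m n)%:R `^ (- (1 + delta)).
pose osc n := ((ma n ^+ 2)%:E * oscillation q (B n) (mV n))%E.
(* When [1 <= ma n], [r n <= ma n ^+ 2], so the scaled oscillation bounds the change of log-quantile
   from [t] to [x] on the scale [r n]. *)
have osc_le b n x : 1 <= ma n -> mV n < b < 1 - mV n -> osc n \is a fin_num ->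
    `|fine (osc n)| <= eps / 4 -> B n x ->
    r n * `|ln (q b x / q b t)| <= eps / 4.
  move=> s1 mb fin oe Bx.
  have s0 : 0 <= ma n by lra.
  apply: (@le_trans _ _ (ma n ^+ 2 * `|ln (q b x / q b t)|)).
    rewrite ler_wpM2r//.
    have r1 : 1 <= r n by rewrite -sqrtr1 ler_wsqrtr.
    by rewrite -(sqr_sqrtr s0) -/(r n) -exprM ler_eXnr.
  apply: le_trans oe; apply: le_trans (ler_norm _).
  rewrite -lee_fin fineK// EFinM lee_wpmul2l ?lee_fin ?sqr_ge0//.
  by apply: ereal_sup_ubound; exists b, x, t.
have Q_cvg z : r n * (ln (q (bracket m a (gamma t) z n) t) - ln (q (a n) t))
    @[n --> \oo] --> z.
  exact: (bracket_quantile_cvg a01 a_cvg0 s_cvgy g0 cA q_gt0).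
pose close z n : Prop := forall x, B n x ->
    0 < bracket m a (gamma t) z n < 1 /\
    r n * `|ln (q (bracket m a (gamma t) z n) x) -
            ln (q (bracket m a (gamma t) z n) t)| <= eps / 4.
have key z : \forall n \near \oo, close z n.
  near=> n => x Bx.
  have /andP[an0 an1] := a01 n.
  have /andP[b1 b2] : a n / 2 < bracket m a (gamma t) z n < 2 * a n.
    by near: n; exact: bracket_near.
  have a4 : a n <= 4^-1.
    by near: n; move: a_cvg0 => /cvgr_le; apply; rewrite invr_gt0.
  have s2 : 2 <= ma n by near: n; move/cvgryPge: s_cvgy; exact.
  have b01 : 0 < bracket m a (gamma t) z n < 1 by apply/andP; split; lra.
  split=> //.
  rewrite -ln_div ?posrE ?q_gt0//.
  have m0 : 0 < (m n)%:R :> R.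
    by rewrite ltr0n lt0n; apply/eqP => m0; move: s2; rewrite /ma m0 mul0r; lra.
  (* The bracket lies in the range of the oscillation: [ma n >= 2] gives [mV <= 1 / m <= a / 2], and
     [2 * a <= 1/2] is below [1 - mV]. *)
  have mVle : mV n <= (m n)%:R^-1.
    have m1 : 1 <= (m n)%:R :> R by rewrite ler1n -(ltr0n R).
    by rewrite /mV -powR_inv1 ?(ltW m0)//; apply: ler_powR => //; lra.
  have mVa : (m n)%:R^-1 <= a n / 2.
    rewrite -(ler_pM2l m0) mulfV ?gt_eqF//; move: s2; rewrite /ma; lra.
  apply: osc_le => //.
  - lra.
  - apply/andP; split; lra.
  - by near: n.
  - near: n; move/cvgr0Pnorm_le: osc_cvg; apply.
    by rewrite divr_gt0.
near=> n.
have keyp : close (y + eps) n by near: n; exact: key.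
have keym : close (y - eps) n by near: n; exact: key.
move=> x Bx.
have r0 : 0 < r n by near: n; move/cvgryPgt: ry; exact.
have ry1 : 0 < 1 + y / r n.
  have : `|y| + 1 < r n by near: n; move/cvgryPgt: ry; exact.
  move=> yr; rewrite -(ltr_pM2l r0) mulr0 mulrDr mulr1 mulrC divfK ?gt_eqF//.
  by have := ler_norm (- y); rewrite normrN; lra.
have qa0 : 0 < q (a n) t by exact: q_gt0.
set u := q (a n) t * (1 + y / r n).
have u0 : 0 < u by rewrite mulr_gt0.
have lnu : ln u = ln (q (a n) t) + ln (1 + y / r n) by rewrite lnM ?posrE.
have ylo : y - eps / 4 <= r n * ln (1 + y / r n).
  by near: n; move: rln => /cvgr_ge; apply; lra.
have yhi : r n * ln (1 + y / r n) <= y + eps / 4.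
  by near: n; move: rln => /cvgr_le; apply; lra.
have [/andP[bp0 bp1] Lp] := keyp x Bx.
have [/andP[bm0 bm1] Lm] := keym x Bx.
have Qp : y + eps - eps / 4 <=
    r n * (ln (q (bracket m a (gamma t) (y + eps) n) t) - ln (q (a n) t)).
  by near: n; have /cvgr_ge := Q_cvg (y + eps); apply; lra.
have Qm : r n * (ln (q (bracket m a (gamma t) (y - eps) n) t) -
                 ln (q (a n) t)) <= y - eps + eps / 4.
  by near: n; have /cvgr_le := Q_cvg (y - eps); apply; lra.
set bp := bracket m a (gamma t) (y + eps) n in bp0 bp1 Lp Qp *.
set bm := bracket m a (gamma t) (y - eps) n in bm0 bm1 Lm Qm *.
have [qbp0 Fbp] : 0 < q bp x /\ F x (q bp x) = 1 - bp by apply: qF; rewrite bp0.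
have [qbm0 Fbm] : 0 < q bm x /\ F x (q bm x) = 1 - bm by apply: qF; rewrite bm0.
have mono (v w : R) : v <= w -> F x v <= F x w.
  by move=> vw; exact: cumulative_is_nondecreasing.
have lin_lo (A A' C L : R) : r n * `|A - A'| <= eps / 4 ->
    y + eps - eps / 4 <= r n * (A' - C) -> r n * L <= y + eps / 4 -> C + L <= A.
  rewrite -(ler_pM2l r0 (C + L)) => h1 h2 h3.
  have := ler_wpM2l (ltW r0) (ler_norm (- (A - A'))).
  rewrite normrN; move: (r n) (`|_|) h1 h2 h3 => ? ?; lra.
have lin_hi (A A' C L : R) : r n * `|A - A'| <= eps / 4 ->
    r n * (A' - C) <= y - eps + eps / 4 -> y - eps / 4 <= r n * L -> A <= C + L.
  rewrite -(ler_pM2l r0 A) => h1 h2 h3.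
  have := ler_wpM2l (ltW r0) (ler_norm (A - A')).
  move: (r n) (`|_|) h1 h2 h3 => ? ?; lra.
have Fp : F x u <= 1 - bp.
  rewrite -Fbp; apply: mono; rewrite -ler_ln ?posrE// lnu.
  exact: lin_lo Lp Qp yhi.
have Fm : 1 - bm <= F x u.
  rewrite -Fbm; apply: mono; rewrite -ler_ln ?posrE// lnu.
  exact: lin_hi Lm Qm ylo.
by move: Fp Fm; clear; lra.
Unshelve. all: by end_near. Qed.

(** * Asymptotic normality *)

(** Open upper half-lines generate the Borel sets, and their preimages are complements of events on
    the number of exceedances. *)
Lemma measurable_order_stat d (T : measurableType d) (R : realType)
    (P : probability T R) (Y : nat -> {RV P >-> R}) (s : seq nat) (k : nat) :
  measurable_fun setT (fun w => order_stat [seq Y i w | i <- s] k).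
Proof.
(* Ranks 0 and 1 read the same item; ranks beyond the size give the constant default 0. *)
wlog k0 : k / (0 < k)%N.
  by case: k => [|k] H; [exact: (H 1%N)|exact: H].
have [ks|sk] := leqP k (size s); last first.
  rewrite (_ : (fun w => _) = cst 0)//; apply/funext => w.
  rewrite /order_stat nth_default// size_sort size_map; lia.
move=> mD; apply: (measurability _ (RGenOInfty.measurableE R)) => //.
move=> /= _ [_ [u ->] <-]; apply: measurableI => //.
rewrite (_ : _ @^-1` _ =
    ~` [set w | (count (fun i => (u < Y i w)%R) s < size s - k + 1)%N]).
  by apply: measurableC; exact: measurable_exceed_count.
apply/seteqP; split => w /=; rewrite in_itv/= andbT;
  have := @order_stat_le R [seq Y i w | i <- s] k u;
  rewrite size_map k0 ks count_map => /(_ isT) <-.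
- by rewrite ltNge => /negP.
- by rewrite ltNge => /negP.
Qed.

Lemma size_local_indices (R : realType) (E : metricType R) (x : nat -> E)
    (t : E) (h : nat -> R) n :
  size [seq i <- iota 0 n | x i \in cball t (h n)] = local_count x t h n.
Proof.
rewrite size_filter -sum1_count big_mkcond /local_count -[iota 0 n]/(iota 0 n).
rewrite -(big_mkord xpredT (fun i => nat_of_bool (x i \in cball t (h n)))).
by rewrite /index_iota subn0; apply: eq_bigr => i _; case: (_ \in _).
Qed.

Theorem theorem1 (R : realType) (E : metricType R)
    (F : E -> cumulativeBounded (0 : R) (1 : R))
    (q : R -> E -> R) (gamma : E -> R)
    (d : measure_display) (T : measurableType d) (P : probability T R)
    (x : nat -> E) (Y : nat -> {RV P >-> R})
    (t : E) (h : nat -> R) (alpha : nat -> R) :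
  let m := local_count x t h in
  let ma := fun n => (m n)%:R * alpha (m n) in
  is_quantile F q ->
  heavy_tailed q gamma ->
  mutually_independent Y ->
  (forall (i : nat) (y : R), cdf (Y i) y = (F (x i) y)%:E) ->
  (forall n, 0 < h n) ->
  h n @[n --> \oo] --> (0 : R) ->
  condition_A q gamma t ->
  (forall n, 0 < alpha (m n) < 1) ->
  alpha (m n) @[n --> \oo] --> (0 : R) ->
  ma n @[n --> \oo] --> +oo ->
  (exists2 delta : R, 0 < delta &
    (((ma n) ^+ 2)%:E
       * oscillation q (cball t (h n)) ((m n)%:R `^ (- (1 + delta))))%E
      @[n --> \oo] --> 0%E) ->
  cvg_in_distribution P
    (fun n w => Num.sqrt (ma n)
       * (qhat1 x (fun i => Y i) t h n (alpha (m n)) w / q (alpha (m n)) t - 1))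
    (normal_prob 0 (gamma t)).
Proof.
move=> m ma qF heavy indep cdfE h0 _ cA a01 a_cvg0 s_cvgy [delta delta0 oscH].
have g0 : 0 < gamma t by have [] := heavy t.
pose J n := [seq i <- iota 0 n | x i \in cball t (h n)].
have sizeJ n : size (J n) = m n by exact: size_local_indices.
split=> [n|y Phi_cont].
  apply: measurable_funM => //; apply: measurable_funB => //.
  by apply: measurable_funM => //; exact: measurable_order_stat.
pose a n := alpha (m n).
pose k n := Num.truncn (ma n).
pose r n := Num.sqrt (ma n).
pose u n := q (a n) t * (1 + y / r n).
pose p n i := 1 - F (x i) (u n).
have q_gt0 n : 0 < q (a n) t by have [] := qF t (a n) (a01 n).
have pE n i : P (Y i @^-1` `]u n, +oo[%classic) = (p n i)%:E.
  have mY : measurable (Y i @^-1` `]-oo, u n]%classic).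
    by apply: (measurable_funPTI (Y i)); exact: measurable_itv.
  rewrite -setCitvl preimage_setC probability_setC//.
  by have := cdfE i (u n); rewrite /cdf /distribution /pushforward /= => ->.
have p01 n i : 0 <= p n i <= 1.
  rewrite -!lee_fin -pE measure_ge0 probability_le1//.
  apply: (measurable_funPTI (Y i) (Y := `]u n, +oo[%classic)).
  exact: measurable_itv.
have ry : r n @[n --> \oo] --> (+oo : set_system R) by exact: sqrtr_cvgy.
have ranks := intermediate_ranks a01 s_cvgy.
have probE : \forall n \near \oo,
    P [set w | r n * (qhat1 x (fun i => Y i) t h n (alpha (m n)) w /
                     q (alpha (m n)) t - 1) <= y] =
    (bernoulli_cdf (map (p n) (J n)) (k n))%:E.
  near=> n.
  have r0 : 0 < r n.
    by near: n; move/cvgryPgt: ry; exact.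
  have [_ mE kE _ _] : [/\ (k n).-1 = below_rank m a n,
      m n = (below_rank m a n + above_rank m a n).+1,
      k n = (below_rank m a n).+1,
      ma n - 2 < (below_rank m a n)%:R & (below_rank m a n)%:R <= ma n - 1].
    by near: n; exact: ranks.
  have := @exceed_count_prob _ T R P Y (u n) (p n) (J n) [::] (fun=> setT) (k n)
    indep (pE n) (fun=> measurableT).
  rewrite cats0 big_nil mul1e => <-; last first.
    by rewrite filter_uniq// iota_uniq.
  congr (P _); apply/seteqP.
  suff H w : (r n * (qhat1 x (fun i => Y i) t h n (a n) w / q (a n) t - 1) <= y) =
      (count (fun i => (u n < Y i w)%R) (J n) < k n)%N.
    by split => w /= => [Hw|[_ Hw]]; [split=> //; rewrite -H|rewrite H].
  (* Solving the inequality for the estimator turns the event into [qhat1 <= u n]. *)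
  rewrite mulrC -ler_pdivlMr// lerBlDl ler_pdivrMr// mulrC -/(u n).
  have kE' : Num.truncn ((m n)%:R * a n) = k n by [].
  rewrite /qhat1 -/(m n) kE'.
  have sizeY : size (local_sample x (fun i => Y i) t h n w) = m n.
    by rewrite size_map sizeJ.
  rewrite order_stat_le sizeY; last by rewrite mE kE; lia.
  rewrite count_map.
  (* The truncated subtractions are true ones here since [0 < k n <= m n]. *)
  have -> : (m n - (m n - k n + 1) + 1 = k n)%N by rewrite mE kE; lia.
  by [].
pose Phi z : R := fine (normal_prob 0 (gamma t) `]-oo, z]%classic).
have binom_cvg z : binomial_cdf (m n) (k n) (bracket m a (gamma t) z n)
    @[n --> \oo] --> Phi z.
  have := @binomial_cdf_cvg_normal R (gamma t) (below_rank m a) (above_rank m a) z g0.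
  have K0 n : (0 < below_rank m a n)%N by exact: leq_maxl.
  have M0 n : (0 < above_rank m a n)%N by exact: leq_maxl.
  move=> /(_ K0 M0 (intermediate_rank_cvgy a01 s_cvgy)
    (intermediate_rank_ratio_cvg0 a01 a_cvg0 s_cvgy)).
  apply: cvg_trans; apply: near_eq_cvg; near=> n.
  have [_ mE kE _ _] : [/\ (k n).-1 = below_rank m a n,
      m n = (below_rank m a n + above_rank m a n).+1,
      k n = (below_rank m a n).+1,
      ma n - 2 < (below_rank m a n)%:R & (below_rank m a n)%:R <= ma n - 1].
    by near: n; exact: ranks.
  by rewrite mE kE.
have Phi_fin z : normal_prob 0 (gamma t) `]-oo, z]%classic \is a fin_num.
  by rewrite fin_num_measure//; exact: measurable_itv.
rewrite -[X in _ --> X](fineK (Phi_fin y)); apply/fine_cvgP; split.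
  near=> n.
  rewrite (_ : P _ = (bernoulli_cdf (map (p n) (J n)) (k n))%:E)//.
  by near: n; exact: probE.
apply/cvgrPdist_le => eps eps0.
(* Continuity of the limit law at [y] provides the shift [e] that costs only [eps / 2]. *)
have Phi_cvg : Phi z @[z --> y] --> Phi y.
  by apply: fine_cvg; rewrite fineK//; exact: Phi_cont.
have [e e0 He] : exists2 e, 0 < e &
    forall z, `|y - z| <= e -> `|Phi y - Phi z| <= eps / 2.
  move: Phi_cvg => /cvgrPdist_le /(_ (eps / 2)); rewrite divr_gt0// => /(_ isT).
  move=> /nbhs_ballP[e /= e0 He]; exists (e / 2); first by rewrite divr_gt0.
  by move=> z yz; apply: He; rewrite /ball /= (le_lt_trans yz)//; lra.
have lo : \forall n \near \oo, Phi (y - e) - eps / 2 <=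
    binomial_cdf (m n) (k n) (bracket m a (gamma t) (y - e) n).
  have /cvgr_ge := binom_cvg (y - e); apply; lra.
have hi : \forall n \near \oo,
    binomial_cdf (m n) (k n) (bracket m a (gamma t) (y + e) n) <=
    Phi (y + e) + eps / 2.
  have /cvgr_le := binom_cvg (y + e); apply; lra.
have tB n : cball t (h n) t by rewrite /cball /= mdistxx ltW.
have cross := exceedance_bracket y qF g0 cA tB a01 a_cvg0 s_cvgy delta0 oscH e0.
near=> n.
have crossn : forall z, cball t (h n) z ->
    bracket m a (gamma t) (y + e) n <= 1 - F z (u n) <=
    bracket m a (gamma t) (y - e) n by near: n; exact: cross.
(* With [a n <= 1/2], the coarse bounds place the lower bracket above 0 and the upper one below 1,
   so both serve as success probabilities. *)
have /andP[bp0 _] : a n / 2 < bracket m a (gamma t) (y + e) n < 2 * a n.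
  by near: n; exact: bracket_near.
have /andP[_ bm1] : a n / 2 < bracket m a (gamma t) (y - e) n < 2 * a n.
  by near: n; exact: bracket_near.
have a2 : a n <= 2^-1.
  by near: n; move: a_cvg0 => /cvgr_le; apply; rewrite invr_gt0.
have /andP[an0 _] : 0 < a n < 1 := a01 n.
have JB i : i \in J n -> cball t (h n) (x i).
  by rewrite mem_filter => /andP[xi _]; rewrite inE in xi.
have constE b : [seq b | _ <- J n] = nseq (m n) b.
  by rewrite -sizeJ; elim: (J n) => //= _ s ->.
(* Larger success probabilities give a smaller distribution function, so the bracket at [y - e], an
   upper bound for every [p n i], yields the lower bound. *)
have Plo : binomial_cdf (m n) (k n) (bracket m a (gamma t) (y - e) n) <=
    bernoulli_cdf (map (p n) (J n)) (k n).
  rewrite -bernoulli_cdf_nseq -constE; apply: le_bernoulli_cdf => i iJ.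
  have /andP[_ pb] := crossn _ (JB i iJ).
  have /andP[pi0 _] := p01 n i.
  by split=> //; lra.
have Pup : bernoulli_cdf (map (p n) (J n)) (k n) <=
    binomial_cdf (m n) (k n) (bracket m a (gamma t) (y + e) n).
  rewrite -bernoulli_cdf_nseq -constE; apply: le_bernoulli_cdf => i iJ.
  have /andP[pb _] := crossn _ (JB i iJ).
  have /andP[_ pi1] := p01 n i.
  by split=> //; lra.
have lon : Phi (y - e) - eps / 2 <=
    binomial_cdf (m n) (k n) (bracket m a (gamma t) (y - e) n) by near: n.
have hin : binomial_cdf (m n) (k n) (bracket m a (gamma t) (y + e) n) <=
    Phi (y + e) + eps / 2 by near: n.
rewrite /= (_ : P _ = (bernoulli_cdf (map (p n) (J n)) (k n))%:E); last first.
  by near: n; exact: probE.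
rewrite -/(Phi y) /=.
have /(He _) : `|y - (y + e)| <= e.
  by rewrite opprD addrA subrr sub0r normrN (ger0_norm (ltW e0)).
have /(He _) : `|y - (y - e)| <= e.
  by rewrite subKr (ger0_norm (ltW e0)).
rewrite !ler_norml => /andP[h1 h2] /andP[h3 h4].
move: Plo Pup lon hin h1 h2 h3 h4.
move: (binomial_cdf _ _ _) (binomial_cdf _ _ _) (bernoulli_cdf _ _).
move: (Phi y) (Phi (y + e)) (Phi (y - e)) => *; apply/andP; split; lra.
Unshelve. all: by end_near. Qed.
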